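(* Let $\xi=(\xi_1,\dots,\xi_N)$ have probability density $f$ on $\mathbb R^N$, let $\mathbf Q\subset\mathbb R^n$ be Borel, $N\ge n$, $k\in\{1,\dots,N\}$, and let $\mathbf Z=(\mathbf z_1^*,\dots,\mathbf z_N^* )$ be vectors in $\mathbb R^n$ such that $\mathbf z_1^*,\dots,\mathbf z_n^*$ form a basis of $\mathbb R^n$. Assume that for each $j=1,\dots,n$ the density $f$ is differentiable with respect to $r_j$ and $\Phi_{kj}(\mathbf r)=\partial(r_kf)/\partial r_j$ is summable on $\mathbb R^N$. Then $h_k$ is differentiable at $\mathbf z_k^*$ and $$\nabla h_k(\mathbf z_k^* )=\sum_{j=1}^n\sum_{i=1}^n\frac{\partial h_k}{\partial\mathbf z_j^*}\,\langle\mathbf e^j,\mathbf e^i\rangle\,\mathbf z_i^*,$$ where $\{\mathbf e^1,\dots,\mathbf e^n\}$ is the dual basis of $\{\mathbf z_1^*,\dots,\mathbf z_n^*\}$ (i.e. $\langle\mathbf e^i,\mathbf z_l^*\rangle=\delta_{il}$) and $\frac{\partial h_k}{\partial\mathbf z_j^*}=\frac{d}{d\varepsilon}h_k(\mathbf z_k^*+\varepsilon\mathbf z_j^* )|_{\varepsilon=0}$.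
   Context: For vectors $\mathbf z_1,\dots,\mathbf z_N\in\mathbb R^n$ put $g(\mathbf z_1,\dots,\mathbf z_N)=\mathbf P\big(\sum_{i=1}^N\xi_i\mathbf z_i\in\mathbf Q\big)$. Given $\mathbf Z=(\mathbf z_1^*,\dots,\mathbf z_N^* )$ and fixed $k$, define $h_k(\mathbf z)=g(\mathbf z_1^*,\dots,\mathbf z_{k-1}^*,\mathbf z,\mathbf z_{k+1}^*,\dots,\mathbf z_N^* )$, $\mathbf z\in\mathbb R^n$. $\langle\cdot,\cdot\rangle$ is the Euclidean inner product. *)

(* Defs.v *)
From HB Require Import structures.
From mathcomp Require Import all_boot all_order all_algebra.
From mathcomp Require Import all_classical all_reals all_analysis.
Set Implicit Arguments. Unset Strict Implicit. Unset Printing Implicit Defensive.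
Import Order.TTheory GRing.Theory Num.Theory.
Import numFieldNormedType.Exports.
Local Open Scope classical_set_scope.
Local Open Scope ring_scope.

Section defs.
Variable R : realType.

Definition inner (n : nat) (u v : 'rV[R]_n) : R := \sum_(l < n) u 0 l * v 0 l.

Definition tupd (N : nat) (r : N.-tuple R) (j : 'I_N) (t : R) : N.-tuple R :=
  [tuple if i == j then t else tnth r i | i < N].

(* lam is Lebesgue measure on R^N: it gives every closed box its volume.
   (Boxes form a pi-system generating the product sigma-algebra and the
   measure is sigma-finite on them, so this pins lam down uniquely.) *)
Definition is_lebesgue_tuple (N : nat)
  (lam : {measure set (N.-tuple R) -> \bar R}) : Prop :=
  forall a b : N.-tuple R,
    lam [set x | forall i, tnth a i <= tnth x i <= tnth b i] =
    (\prod_(i < N) Num.max (tnth b i - tnth a i) 0)%:E.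

Definition has_density (T : measurableType default_measure_display) (N : nat)
  (lam : {measure set (N.-tuple R) -> \bar R})
  (P : probability T R) (xi : T -> N.-tuple R) (f : N.-tuple R -> R) : Prop :=
  [/\ measurable_fun setT xi, measurable_fun setT f, (forall r, 0 <= f r) &
      forall A, measurable A ->
        P (xi @^-1` A) = (\int[lam]_(x in A) (f x)%:E)%E].

Definition gprob (T : measurableType default_measure_display) (N n : nat)
  (P : probability T R) (xi : T -> N.-tuple R) (Q : set 'rV[R]_n)
  (z : 'I_N -> 'rV[R]_n) : R :=
  fine (P [set w | Q (\sum_(i < N) tnth (xi w) i *: z i)]).

Definition hk (T : measurableType default_measure_display) (N n : nat)
  (P : probability T R) (xi : T -> N.-tuple R) (Q : set 'rV[R]_n)
  (Z : 'I_N -> 'rV[R]_n) (k : 'I_N) (z : 'rV[R]_n) : R :=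
  gprob P xi Q (fun i => if i == k then z else Z i).

Definition gradient (n : nat) (h : 'rV[R]_n -> R) (a : 'rV[R]_n) : 'rV[R]_n :=
  \row_(l < n) ('D_(delta_mx 0 l) h a).

Definition Phi (N : nat) (f : N.-tuple R -> R) (k j : 'I_N) (r : N.-tuple R) : R :=
  derive1 (fun t => tnth (tupd r j t) k * f (tupd r j t)) (tnth r j).

End defs.

(* Main.v *)
(* Write v = sum_j v_j z_j in the basis. Then h_k(z_k + v) is the integral of f
   over the preimage of B = {r | sum_i r_i z_i in Q} under r |-> r + r_k v, and
   this linear map is a composition of maps r |-> r + t r_k e_j moving one
   coordinate each ("shears", including the dilation j = k). The push-forward of
   f by the shear of parameter t is a density f_t whose t-derivative is, up to
   the Jacobian, minus the push-forward of Phi_kj. Hence |f_t - f|_1 is at most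
   |t| |Phi_kj|_1 / (1 - |t|), by the fundamental theorem of calculus for an
   everywhere differentiable function and Tonelli; as (f_t - f) / t tends to
   - Phi_kj pointwise, Scheffe's lemma makes the convergence hold in L^1.
   Telescoping over the coordinates gives the first order expansion of h_k with
   derivative v |-> - sum_j v_j int_B Phi_kj, and the formula for the gradient
   is then linear algebra. *)
Require Import Defs.
From HB Require Import structures.
From mathcomp Require Import all_boot all_order all_algebra.
From mathcomp Require Import all_classical all_reals all_analysis.
From mathcomp Require Import measurable_realfun ring lra.
Import Order.TTheory GRing.Theory Num.Theory.
Import numFieldNormedType.Exports.
Local Open Scope classical_set_scope.
Local Open Scope ring_scope.

Set Implicit Arguments.
Unset Strict Implicit.
Unset Printing Implicit Defensive.

(** * Increments of everywhere differentiable functions *)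

(** The derivative of [f] in a coordinate is only known to exist everywhere, and [Phi] to be
    summable on the whole space; along a single line the derivative may be neither continuous nor
    integrable. So the fundamental theorem enters only as an inequality between an increment and the
    integral of a nonnegative majorant, valid also when that integral is infinite. The difference
    quotients come with no integrable majorant, so dominated convergence does not apply to them
    directly. Scheffe's lemma asks only that their norms be asymptotically at most the norm of the
    limit, and for this the constant in the increment bound must tend to exactly [1]. Every L^1
    estimate is turned into a bound uniform over measurable sets. Peeling off one shear leaves the
    preimage of [B] under the remaining ones, a set that moves with the parameters; uniformity makes
    the telescoping possible and gives differentiability in all directions at once. *)

Section increments.
Context {R : realType}.
Notation leb := (@lebesgue_measure R).

(** Continuous induction: the points [x] where the bound holds from [a] to [x] have a supremum at
    which it still holds, and [loc] moves past it unless it is [b]. At the supremum, continuity of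
    [g] costs an arbitrary [e], while [I] only has to be monotone because the approach is from the
    left. *)
Lemma increment_le_of_local (g I : R -> R) (a b : R) : a <= b ->
  {in `[a, b], forall x, {for x, continuous g}} ->
  {in `[a, b] &, forall x y, x <= y -> I x <= I y} ->
  {in `[a, b[, forall x, exists2 d, 0 < d &
     forall y, x < y < x + d -> y <= b -> g y - g x <= I y - I x} ->
  g b - g a <= I b - I a.
Proof.
move=> ab gc Ind loc.
pose S := [set x | x \in `[a, b] /\ g x - g a <= I x - I a].
have Sa : S a by split; rewrite ?bound_itvE// !subrr.
have Sub : ubound S b by move=> x [/itvP ->].
have Ssup : has_sup S by split; [exists a|exists b].
have ac : a <= sup S by apply: ub_le_sup => //; exists b.
have cb : sup S <= b by apply: ge_sup => //; exists a.
have cab : sup S \in `[a, b] by rewrite in_itv/= ac.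
have Sc : S (sup S).
  split => //; apply/ler_addgt0Pr => e e0.
  have /cvgrPdist_lt/(_ e e0)[d /= d0 gd] := gc _ cab.
  have [x [xab gx] cx] := sup_adherent d0 Ssup.
  have xc : x <= sup S by apply: ub_le_sup; [exists b|].
  have := gd x; rewrite /ball/= ger0_norm ?subr_ge0// ltrBlDl -ltrBlDr.
  move=> /(_ cx); rewrite ltr_norml => /andP[_ h].
  have := Ind _ _ xab cab xc; lra.
have [<-|cb'] := eqVneq (sup S) b; first by case: Sc.
have {}cb' : sup S < b by rewrite lt_neqAle cb'.
have [d d0 hd] : exists2 d, 0 < d &
    forall y, sup S < y < sup S + d -> y <= b ->
      g y - g (sup S) <= I y - I (sup S).
  by apply: loc; rewrite in_itv/= ac.
pose y := Num.min (sup S + d / 2) b.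
have cy : sup S < y by rewrite /y lt_min cb' andbT; lra.
have yb : y <= b by rewrite /y ge_min lexx orbT.
have yd : y <= sup S + d / 2 by rewrite /y ge_min lexx.
have : S y.
  split; first by rewrite in_itv/= yb andbT (le_trans ac)// ltW.
  have := hd y; rewrite cy/= => /(_ _ yb).
  by case: Sc => _ h; move=> h'; have /h' : y < sup S + d; lra.
by move=> /(ub_le_sup (ex_intro _ b Sub)); rewrite leNgt cy.
Qed.

(* Cover each level set [E n = {n c <= p < (n+1) c}] of [p] by a slightly larger
   open set [U n]; the integral of [W = sum_n (n+1) c 1_(U n)] then grows at rate
   at least [(n+1) c] to the right of every point of [E n], faster than [g]. *)
Lemma increment_le_integral (g p : R -> R) (a b : R) : a <= b ->
  measurable_fun `[a, b] p ->
  {in `[a, b], forall x, 0 <= p x} ->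
  {in `[a, b], forall x, derivable g x 1} ->
  {in `[a, b], forall x, derive1 g x <= p x} ->
  ((g b - g a)%:E <= \int[leb]_(x in `[a, b]) (p x)%:E)%E.
Proof.
move=> ab mp p0 gd gp.
have mI x y : measurable (`[x, y] : set R) by exact: measurable_itv.
apply/lee_addgt0Pr => e0 e0_gt0.
(* Half of the error [e0] pays for rounding [p] up to a multiple of [c], the other half for the
   overshoot of the open sets. The [+ 1] covers [a = b]. *)
pose c := e0 / 2 / (b - a + 1).
have ba1 : 0 < b - a + 1 by lra.
have c0 : 0 < c by rewrite !divr_gt0.
have cba : c * (b - a) <= e0 / 2.
  by rewrite /c mulrAC ler_pdivrMr// ler_wpM2l//; lra.
pose E n := `[a, b] `&` p @^-1` `[n%:R * c, n.+1%:R * c[.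
have mE n : measurable (E n) by apply: mp => //; exact: measurable_itv.
have Ep n x : E n x -> n%:R * c <= p x < n.+1%:R * c by case=> _ /=; rewrite in_itv.
have tE : trivIset setT E.
  apply/trivIsetP => i j _ _ ij; apply/seteqP; split => // x [/Ep /andP[xi1 xi2] /Ep /andP[xj1 xj2]].
  have := le_lt_trans xi1 xj2; have := le_lt_trans xj1 xi2.
  rewrite !ltr_pM2r// !ltr_nat !ltnS => ji i_j.
  by move: ij; rewrite eqn_leq i_j ji.
have EU : \bigcup_n E n = `[a, b]%classic.
  apply/seteqP; split => [x [n _ []//]|x xab].
  have px0 : 0 <= p x / c by rewrite divr_ge0 ?p0 ?(ltW c0).
  have /andP[h1 h2] := truncn_itv px0.
  exists (Num.truncn (p x / c)) => //; split => //=.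
  by rewrite in_itv/= -ler_pdivlMr// h1 -ltr_pdivrMr.
(* Weighted by [n.+1%:R * c], the part of [U n] outside [E n] then costs at most
   [e0 / 2 / 2 ^ n.+1], and these costs sum to [e0 / 2]. *)
pose del n := e0 / 2 / (2 ^ n.+1)%:R / (n.+1%:R * c).
have del0 n : 0 < del n by rewrite !divr_gt0// mulr_gt0.
have lebE n : (leb (E n) < +oo)%E.
  apply: (@le_lt_trans _ _ (leb `[a, b]%classic)); last first.
    by rewrite lebesgue_measure_itv; case: ifP => //=; rewrite -EFinD ltry.
  apply: le_measure; rewrite ?inE; [exact: mE|exact: mI|by move=> x []].
have /choice[U HU] n : exists U : set R,
    [/\ open U, E n `<=` U & (leb (U `\` E n) < (del n)%:E)%E].
  by apply: lebesgue_regularity_outer; [exact: mE|exact: lebE|exact: del0].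
have Uo n : open (U n) by case: (HU n).
have mU n : measurable (U n) by exact: open_measurable.
pose w n x : \bar R := ((n.+1%:R * c) * \1_(U n) x)%:E.
have w0 n x : (0 <= w n x)%E by rewrite lee_fin indicE; apply: mulr_ge0 => //; exact: mulr_ge0 (ler0n _ _) (ltW c0).
have mUE n : measurable (U n `\` E n) by apply: measurableD; [exact: mU|exact: mE].
have mUEab n : measurable ((U n `\` E n) `&` `[a, b]%classic).
  by apply: measurableI; [exact: mUE|exact: mI].
have mi n (D : set R) : measurable_fun D (fun x => (\1_(U n) x)%:E : \bar R).
  by apply/measurable_EFinP; exact: measurable_indic.
have mw n (D : set R) : measurable_fun D (w n).
  by apply/measurable_EFinP; apply: measurable_funM => //; exact: measurable_indic.
pose W x : \bar R := (\sum_(n <oo) w n x)%E.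
have W0 x : (0 <= W x)%E by exact: nneseries_ge0.
have mW (D : set R) : measurable D -> measurable_fun D W.
  move=> mD; apply: (eq_measurable_fun (fun x => \sum_(n <oo | n \in xpredT) w n x)%E) => //.
  by apply: ge0_emeasurable_sum => // n _; exact: mw.
pose m x := (\int[leb]_(y in `[a, x]) W y)%E.
have m0 x : (0 <= m x)%E by exact: integral_ge0.
have mb : (m b <= \int[leb]_(x in `[a, b]) (p x)%:E + e0%:E)%E.
  rewrite /m integral_nneseries//; last by move=> n; exact: mw.
  have h n : (\int[leb]_(x in `[a, b]) w n x <=
      \int[leb]_(x in E n) (p x + c)%:E + (e0 / 2 / (2 ^ n.+1)%:R)%:E)%E.
    have nc0 : 0 <= n.+1%:R * c by rewrite mulr_ge0// ltW.
    rewrite (_ : (fun=> _) = fun x => ((n.+1%:R * c)%:E * (\1_(U n) x)%:E)%E); last first.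
      by apply/funext => x; rewrite -EFinM.
    rewrite ge0_integralZl_EFin//; last exact: mi.
    rewrite integral_indic; [|exact: mI|exact: mU].
    have -> : U n `&` `[a, b]%classic = E n `|` ((U n `\` E n) `&` `[a, b]%classic).
      case: (HU n) => _ EnU _.
      apply/seteqP; split => x.
        by move=> [Ux xab]; have [?|?] := pselect (E n x); [left|right].
      by case => [Ex|[[Ux _] xab]]; split => //; [exact: EnU|case: Ex].
    apply: (@le_trans _ _ ((n.+1%:R * c)%:E * (leb (E n) + (del n)%:E)))%E.
      rewrite lee_wpmul2l//.
      apply: (@le_trans _ _ (leb (E n) + leb ((U n `\` E n) `&` `[a, b]%classic))%E).
        by apply: measureU2; [exact: mE|exact: mUEab].
      rewrite leeD2l// (@le_trans _ _ (leb (U n `\` E n)))//; last by case: (HU n) => _ _ /ltW.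
      by apply: le_measure; rewrite ?inE; [exact: mUEab|exact: mUE|move=> x []].
    rewrite ge0_muleDr; [|exact: measure_ge0|by rewrite lee_fin ltW].
    apply: leeD; last first.
      rewrite -EFinM lee_fin /del mulrCA divff ?mulr1//.
      by rewrite gt_eqF// mulr_gt0.
    have -> : ((n.+1%:R * c)%:E * leb (E n) =
        \int[leb]_(x in E n) (n.+1%:R * c)%:E)%E.
      by rewrite integral_cst//; exact: mE.
    apply: ge0_le_integral => //.
    - exact: mE.
    - by apply/measurable_EFinP; apply: measurable_funD => //;
        apply: measurable_funS mp => // x [].
    - move=> x /Ep /andP[px _]; rewrite lee_fin -natr1 mulrDl mul1r.
      by rewrite lerD2r.
  apply: (@le_trans _ _ (\sum_(n <oo) (\int[leb]_(x in E n) (p x + c)%:E + (e0 / 2 / (2 ^ n.+1)%:R)%:E))%E).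
    by apply: lee_nneseries => [n _ _|n _]; [exact: integral_ge0|exact: h].
  have pc0 x : `[a, b]%classic x -> (0 <= (p x + c)%:E)%E.
    by move=> xab; rewrite lee_fin addr_ge0 ?p0 ?ltW.
  apply: (le_trans (epsilon_trick _ _ _)).
  - by move=> n; apply: integral_ge0 => x [xab _]; exact: pc0.
  - by rewrite divr_ge0 ?ltW.
  rewrite -ge0_integral_bigcup//; last 2 first.
  - rewrite EU; apply/measurable_EFinP; exact: measurable_funD.
  - by rewrite EU.
  rewrite EU; under eq_integral do rewrite EFinD.
  rewrite ge0_integralD; [|exact: mI|by move=> x xab; rewrite lee_fin p0|
    exact/measurable_EFinP|by move=> x _; rewrite lee_fin ltW|exact: measurable_cst].
  have -> : (\int[leb]_(_ in `[a, b]) c%:E = c%:E * leb `[a, b]%classic)%E.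
    by rewrite integral_cst.
  rewrite -addeA leeD2l// lebesgue_measure_itv/= lte_fin.
  by case: ifPn => ?; rewrite ?mule0 -?EFinD -?EFinM -?EFinD ?lee_fin ?add0e ?lee_fin; lra.
(* An infinite integral makes the claim trivial; otherwise [m] is finite on [[a, b]] and [fine]
   loses nothing. *)
have [pfin|] := boolP (\int[leb]_(x in `[a, b]) (p x)%:E < +oo)%E; last first.
  by rewrite -leNgt leye_eq => /eqP ->; rewrite addye// leey.
have mfin x : x <= b -> m x \is a fin_num.
  move=> xb; rewrite ge0_fin_numE//.
  apply: (@le_lt_trans _ _ (m b)); last by apply: (le_lt_trans mb); rewrite lte_add_pinfty// ltry.
  apply: ge0_subset_integral => //; first exact: mW.
  by move=> y /=; rewrite !in_itv/= => /andP[-> /le_trans ->].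
have mD x y : a <= x -> x <= y -> m y = (m x + \int[leb]_(z in `]x, y]) W z)%E.
  move=> ax xy.
  have U3 : `[a, y]%classic = `[a, x]%classic `|` `]x, y]%classic.
    apply/seteqP; split => z /=; rewrite !in_itv/=.
      by move=> /andP[az zy]; case: (leP z x) => zx; [left|right]; rewrite ?az.
    by case=> /andP[az zx]; apply/andP; split => //; lra.
  have mxy : measurable (`]x, y]%classic : set R) by exact: measurable_itv.
  rewrite /m U3; apply: ge0_integral_setU => //.
  - by apply: mW; apply: measurableU; [exact: mI|exact: mxy].
  - apply/disj_set2P; rewrite -subset0 => z [/=]; rewrite !in_itv/= => /andP[_ zx] /andP[].
    by rewrite ltNge zx.
suff : g b - g a <= fine (m b) - fine (m a).
  have -> : fine (m a) = 0 by rewrite /m set_itv1 integral_set1.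
  rewrite subr0 -lee_fin fineK ?mfin// => /le_trans; exact.
apply: (@increment_le_of_local g (fun x => fine (m x))) => //.
- move=> x xab; apply/differentiable_continuous; exact/derivable1_diffP/gd.
- move=> x y; rewrite !in_itv/= => /andP[ax xb] /andP[ay yb] xy.
  by rewrite fine_le ?mfin// (mD x y)// leeDl// integral_ge0.
- move=> x; rewrite in_itv/= => /andP[ax xb].
  have xab : x \in `[a, b] by rewrite in_itv/= ax ltW.
  have [n _ Enx] : (\bigcup_n E n) x by rewrite EU.
  have /Ep /andP[_ pxn] := Enx.
  have [_ /(_ _ Enx) Unx _] := HU n.
  have Dg : h^-1 *: (g (h *: (1 : R) + x) - g x) @[h --> (0 : R)^'] --> derive1 g x.
    by rewrite derive1E; exact: gd.
  move/cvgrPdist_lt : Dg.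
  (* The level sets are open on the right, so this bound is strict and chords starting at [x] have
     slope below [n.+1%:R * c] nearby. *)
  have gpos : 0 < n.+1%:R * c - derive1 g x.
    by rewrite subr_gt0; apply: le_lt_trans pxn; exact: gp.
  move=> /(_ _ gpos); rewrite near_withinE /= => -[d1 /= d10 Hd1].
  have /nbhs_ballP[d2 /= d20 Hd2] : nbhs x (U n) by exact: open_nbhs_nbhs.
  exists (Num.min d1 d2); first by rewrite lt_min d10.
  move=> y /andP[xy yd] yb.
  have [yd1 yd2] : y - x < d1 /\ y - x < d2.
    by move: yd; rewrite -ltrBlDl lt_min => /andP[].
  have ay : a <= y by rewrite (le_trans ax)// ltW.
  apply: (@le_trans _ _ ((n.+1%:R * c) * (y - x))).
    rewrite -ler_pdivrMr ?subr_gt0//.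
    have := Hd1 (y - x); rewrite /ball/= sub0r normrN gtr0_norm ?subr_gt0//.
    move=> /(_ yd1); rewrite subr_eq0 gt_eqF// => /(_ isT).
    rewrite /GRing.scale/= mulr1 subrK mulrC.
    by rewrite ltr_norml => /andP[+ _]; lra.
  rewrite -lee_fin EFinB !fineK ?mfin ?(ltW xb)//.
  rewrite (mD x y ax (ltW xy)) addeAC subee ?mfin ?(ltW xb)// add0e.
  apply: (@le_trans _ _ (\int[leb]_(z in `]x, y]) (n.+1%:R * c)%:E)%E).
    have -> : (\int[leb]_(_ in `]x, y]) (n.+1%:R * c)%:E =
        (n.+1%:R * c)%:E * leb `]x, y]%classic)%E.
      by rewrite integral_cst//; exact: measurable_itv.
    by rewrite lebesgue_measure_itv/= lte_fin xy EFinM EFinB.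
  apply: ge0_le_integral => //.
  + by move=> z _; rewrite lee_fin mulr_ge0// ltW.
  + exact: mW.
  + move=> z /=; rewrite in_itv/= => /andP[xz zy].
    have Unz : U n z.
      apply: Hd2; rewrite /ball/= ltr0_norm ?subr_lt0//; lra.
    apply: le_trans (nneseries_lim_ge n.+1 _) => //.
    rewrite big_nat_recr//= (@le_trans _ _ (w n z))//.
      by rewrite /w indicE mem_set// mulr1.
    by rewrite leeDr// sume_ge0.
Qed.

End increments.

(** * Lebesgue measure on tuples *)

Section box.
Context {R : realType} {N : nat}.
Implicit Types (a b r : N.-tuple R) (A : set (N.-tuple R)).

Definition box a b : set (N.-tuple R) :=
  [set x | forall i, tnth a i <= tnth x i <= tnth b i].

Lemma measurable_box a b : measurable (box a b).
Proof.
rewrite (_ : box a b = \bigcap_(i in [set: 'I_N])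
    ((tnth (T := R))^~ i @^-1` `[tnth a i, tnth b i]%classic)); last first.
  apply/seteqP; split => [x xab i _ /=|x xab i]; first by rewrite in_itv/= xab.
  by have := xab i I; rewrite /= in_itv.
apply: fin_bigcap_measurable; first exact: finite_finset.
move=> i _; rewrite -[X in measurable X]setTI.
by apply: measurable_tnth => //; exact: measurable_itv.
Qed.

Let boxes := [set B : set (N.-tuple R) | exists a b, B = box a b].

Let cube (n : nat) := box [tuple - n%:R | i < N] [tuple n%:R | i < N].

Let cube_cover : \bigcup_n cube n = setT.
Proof.
apply/seteqP; split => // x _.
exists (Num.truncn (\sum_(l < N) `|tnth x l|)).+1 => // l.
rewrite !tnth_mktuple -ler_norml (@le_trans _ _ (\sum_(l < N) `|tnth x l|))//.
  by rewrite (bigD1 l)//= lerDl sumr_ge0.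
by rewrite ltW// truncnS_gt.
Qed.

(** For the nontrivial inclusion it suffices that the coordinates are measurable for the
    sigma-algebra generated by boxes: the preimage of a closed half-line is a countable union of
    boxes whose other sides grow. *)
Lemma tuple_measurableE :
  (measurable : set (set (N.-tuple R))) = <<s boxes >>.
Proof.
apply/seteqP; split; last first.
  apply: smallest_sub; first exact: sigma_algebra_measurable.
  by move=> _ [a [b ->]]; exact: measurable_box.
have idm : measurable_fun [set: g_sigma_algebraType boxes]
    (fun x : g_sigma_algebraType boxes => (x : N.-tuple R)).
  apply/measurable_fun_tnthP => i.
  apply: (@measurability _ _ _ (measurableTypeR R) _ _ (@RGenCInfty.G R)).
    exact: RGenCInfty.measurableE.
  move=> _ [_ [x ->] <-].
  rewrite setTI (_ : _ @^-1` _ = \bigcup_n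
     box [tuple if l == i then x else - n%:R | l < N] [tuple n%:R | l < N]); last first.
    apply/seteqP; split => [y /=|y [n _ /(_ i)]]; last first.
      by rewrite !tnth_mktuple eqxx /= in_itv/= andbT => /andP[].
    rewrite in_itv/= andbT => xy.
    exists (Num.truncn (\sum_(l < N) `|tnth y l|)).+1 => // l.
    have yl : `|tnth y l| <= (Num.truncn (\sum_(l < N) `|tnth y l|)).+1%:R.
      apply: (@le_trans _ _ (\sum_(l < N) `|tnth y l|)).
        by rewrite (bigD1 l)//= lerDl sumr_ge0.
      by rewrite ltW// truncnS_gt.
    move: yl; rewrite ler_norml !tnth_mktuple => /andP[y1 ->].
    by rewrite andbT; case: eqP => [->|].
  apply: bigcupT_measurable => n; apply: sub_sigma_algebra.
  by do 2 eexists.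
by move=> A mA; have := idm measurableT A mA; rewrite setTI.
Qed.

Lemma tuple_measure_unique (m1 m2 : {measure set (N.-tuple R) -> \bar R}) :
  (forall a b, m1 (box a b) = m2 (box a b)) ->
  (forall a b, (m1 (box a b) < +oo)%E) ->
  forall A, measurable A -> m1 A = m2 A.
Proof.
move=> m12 m1oo A mA.
apply: (measure_unique boxes cube) => //.
- exact: tuple_measurableE.
- move=> _ _ [a [b ->]] [a' [b' ->]].
  exists [tuple Num.max (tnth a i) (tnth a' i) | i < N],
    [tuple Num.min (tnth b i) (tnth b' i) | i < N].
  apply/seteqP; split => [x [xa xa'] i|x xx].
    by rewrite !tnth_mktuple ge_max le_min; case/andP: (xa i) (xa' i) => -> -> /andP[-> ->].
  by split => i; have := xx i; rewrite !tnth_mktuple ge_max le_min;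
    move=> /andP[/andP[? ?] /andP[? ?]]; apply/andP.
- by move=> n; do 2 eexists.
- by move=> _ [a [b ->]]; exact: m12.
- by move=> n; exact: m1oo.
Qed.

Lemma lebesgue_tuple_sigma_finite (lam : {measure set (N.-tuple R) -> \bar R}) :
  is_lebesgue_tuple lam -> sigma_finite setT lam.
Proof.
move=> hlam; exists cube; last first.
  by move=> n; split; [exact: measurable_box|rewrite hlam ltry].
exact/esym/cube_cover.
Qed.

End box.

(** Packs the push-forward as a measure, so that uniqueness theorems apply to it while later steps
    rewrite only with an equation of set functions. *)
Lemma pushforward_measureP d d' (T1 : measurableType d) (T2 : measurableType d')
    (R : realType) (m : {measure set T1 -> \bar R}) (f : T1 -> T2) :
  measurable_fun setT f ->
  exists pm : {measure set T2 -> \bar R}, pm = pushforward m f :> (set T2 -> \bar R).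
Proof. by move=> mf; unshelve eexists (pushforward m f). Qed.

Section affine.
Context {R : realType}.
Notation leb := (@lebesgue_measure R).

(** The push-forward of Lebesgue measure scaled by [al] gives half-open intervals their length, so
    it is Lebesgue measure by uniqueness. *)
Lemma lebesgue_measure_affine (al be : R) (Y : set R) : 0 < al -> measurable Y ->
  leb ((fun u => al * u + be) @^-1` Y) = (al^-1%:E * leb Y)%E.
Proof.
move=> al0 mY.
pose phi (u : measurableTypeR R) : measurableTypeR R := al * u + be.
have mphi : measurable_fun setT phi.
  by apply: measurable_funD => //; exact: measurable_funM.
have [pm pmE] := pushforward_measureP leb mphi.
pose m : {measure set (measurableTypeR R) -> \bar R} :=
  mscale (NngNum (ltW al0)) pm.
have mE Z : m Z = (al%:E * leb (phi @^-1` Z))%E by rewrite /m /= /mscale pmE.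
have -> : leb Y = m Y.
  apply: lebesgue_measure_unique => // X /ocitvP[->|[[x y] /= xy ->]].
    by rewrite !measure0.
  rewrite mE.
  have -> : phi @^-1` `]x, y] = `](x - be) / al, (y - be) / al]%classic.
    apply/seteqP; split => u /=; rewrite /phi !in_itv/=;
      by rewrite ltr_pdivrMr// ler_pdivlMr// ltrBlDr lerBrDr (mulrC u).
  have xy' : (x - be) / al < (y - be) / al by rewrite ltr_pM2r ?invr_gt0// ltrD2r.
  transitivity ((y - x)%:E); first by rewrite lebesgue_measure_itv/= lte_fin xy.
  rewrite lebesgue_measure_itv/= lte_fin xy'.
  by rewrite -!EFinB -EFinM; congr EFin; field; rewrite gt_eqF.
by rewrite mE muleA -EFinM mulVf ?gt_eqF// mul1e.
Qed.

End affine.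

Section tupd.
Context {R : realType} {N : nat}.
Implicit Types (r : N.-tuple R) (i j : 'I_N) (s t : R).

Lemma tnth_tupd r i j t : tnth (tupd r j t) i = if i == j then t else tnth r i.
Proof. by rewrite tnth_mktuple. Qed.

Lemma tupd_tupd r j s t : tupd (tupd r j s) j t = tupd r j t.
Proof. by apply: eq_from_tnth => i; rewrite !tnth_tupd; case: eqP. Qed.

Lemma tupd_id r j : tupd r j (tnth r j) = r.
Proof. by apply: eq_from_tnth => i; rewrite !tnth_tupd; case: eqP => [->|]. Qed.

Lemma tupdC r i j s t : i != j ->
  tupd (tupd r i s) j t = tupd (tupd r j t) i s.
Proof.
move=> ij; apply: eq_from_tnth => l; rewrite !tnth_tupd.
by case: eqP => // ->; rewrite eq_sym (negbTE ij).
Qed.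

Lemma measurable_fun_tupd d (T : measurableType d) (f : T -> N.-tuple R)
    (g : T -> R) j : measurable_fun setT f -> measurable_fun setT g ->
  measurable_fun setT (fun x => tupd (f x) j (g x)).
Proof.
move=> mf mg; apply/measurable_fun_tnthP => i.
rewrite (_ : _ \o _ = if i == j then g else (fun x => tnth (f x) i)); last first.
  by apply/funext => x /=; rewrite tnth_tupd; case: eqP.
by case: eqP => // _; move/measurable_fun_tnthP : mf; exact.
Qed.

End tupd.

Section slab.
Context {R : realType} {N : nat}.
Notation leb := (@lebesgue_measure R).
Variable lam : {measure set (N.-tuple R) -> \bar R}.
Hypothesis lamP : is_lebesgue_tuple lam.

(* Disintegration along the j-th coordinate; restricting the outer variable to
   the slab [0 <= r_j <= 1] of unit width replaces integrating over R^(N-1). *)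
Lemma lebesgue_tuple_slab (j : 'I_N) (mS : measurable [set r : N.-tuple R | 0 <= tnth r j <= 1]) A :
  measurable A ->
  lam A = (\int[mrestr lam mS]_r leb [set u | A (tupd r j u)])%E.
Proof.
move=> mA.
(* The right-hand side is the measure of [A] under the image of slab times line by [th], so
   comparing with [lam] on boxes is enough. *)
pose th (q : N.-tuple R * measurableTypeR R) := tupd q.1 j q.2.
have mth : measurable_fun setT th by apply: measurable_fun_tupd.
have [M ME] := pushforward_measureP (mrestr lam mS \x leb)%E mth.
transitivity (M A); last first.
  rewrite ME /pushforward /product_measure1; apply: eq_integral => r _.
  by congr (leb _); apply/seteqP; split => u; rewrite /xsection/= inE.
apply: tuple_measure_unique => // [a b|a b]; last by rewrite [X in (X < _)%E]lamP ltry.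
rewrite [LHS]lamP ME /pushforward.
(* [X] keeps the constraints on the coordinates other than [j]. Inside the slab it becomes the box
   from [a'] to [b'], whose side along [j] is [1], so its volume is the product of the other
   sides. *)
pose a' := tupd a j 0; pose b' := tupd b j 1.
pose X := [set r : N.-tuple R | forall i, i != j ->
  tnth a i <= tnth r i <= tnth b i].
rewrite (_ : _ @^-1` _ = X
    `*` `[tnth a j, tnth b j]%classic); last first.
  apply/seteqP; split => [[r u] /= h|[r u] /= [h1 h2] i]; last first.
    by rewrite /th tnth_tupd; case: eqP => [->|/eqP]; [move: h2; rewrite in_itv|exact: h1].
  split; last by have := h j; rewrite /th tnth_tupd eqxx in_itv.
  by move=> i ij; have := h i; rewrite /th tnth_tupd (negbTE ij).
have h : X
    `&` [set r | 0 <= tnth r j <= 1] = box a' b'.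
  apply/seteqP; split => [r [h1 h2] i|r h].
    by rewrite !tnth_tupd; case: eqP => [->//|/eqP]; exact: h1.
  split => [i ij|]; first by have := h i; rewrite !tnth_tupd (negbTE ij).
  by have := h j; rewrite !tnth_tupd eqxx.
have mB : measurable X.
  rewrite (_ : X = \bigcap_(i in [set i | i != j])
      ((tnth (T := R))^~ i @^-1` `[tnth a i, tnth b i]%classic)); last first.
    apply/seteqP; split => [x xab i ij /=|x xab i ij]; first by rewrite in_itv/= xab.
    by have := xab i ij; rewrite /= in_itv.
  apply: fin_bigcap_measurable; first exact: finite_finset.
  move=> i _; rewrite -[Y in measurable Y]setTI.
  by apply: measurable_tnth => //; exact: measurable_itv.
transitivity (mrestr lam mS X
    * leb `[tnth a j, tnth b j]%classic)%E; last first.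
  by apply/esym; apply: product_measure1E => //; exact: measurable_itv.
rewrite /mrestr h [Y in (Y * _)%E]lamP.
rewrite lebesgue_measure_itv/= lte_fin.
rewrite (bigD1 j)//= [in RHS](bigD1 j)//= !tnth_tupd eqxx subr0.
have -> : \prod_(i < N | i != j) Num.max (tnth b' i - tnth a' i) 0 =
    \prod_(i < N | i != j) Num.max (tnth b i - tnth a i) 0.
  by apply: eq_bigr => i ij; rewrite !tnth_tupd (negbTE ij).
rewrite (max_l ler01) mul1r mulrC; case: ltP => ab.
  by rewrite -EFinB -EFinM max_l// subr_ge0 ltW.
by rewrite mule0 max_r ?mulr0// subr_le0.
Qed.

End slab.

(** * Shears *)

Section shear.
Context {R : realType} {N : nat}.
Variable k : 'I_N.
Implicit Types (j : 'I_N) (t : R) (r : N.-tuple R) (B : set (N.-tuple R)).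

Definition shear j t r : N.-tuple R := tupd r j (tnth r j + t * tnth r k).

(* [jac j t] is the determinant of [shear j t], and [shear j (- t / jac j t)] is
   its inverse both when [j = k] and when [j != k]. *)
Definition jac j t : R := 1 + (j == k)%:R * t.

(* The density of the image under [shear j t] of the measure of density [u]. *)
Definition pushed (u : N.-tuple R -> R) j t r : R := u (shear j (- t / jac j t) r) / jac j t.

Lemma shearK j t r : jac j t != 0 -> shear j (- t / jac j t) (shear j t r) = r.
Proof.
rewrite /jac /shear => J0; rewrite !tnth_tupd tupd_tupd eqxx -[RHS](tupd_id _ j); congr tupd.
move: J0; have [jk|jk] := eqVneq j k => /= J0.
  by rewrite jk; rewrite mul1r in J0 *; field.
by rewrite mul0r addr0 divr1 mulNr addrK.
Qed.

(** On a line parallel to the [j]-th axis the shear is affine of slope [jac j t]. The translation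
    vanishes when [j = k], since then the factor [tnth r k] is the running variable itself. *)
Lemma shear_tupd j t r u :
  shear j t (tupd r j u) = tupd r j (jac j t * u + t * (j != k)%:R * tnth r k).
Proof.
rewrite /shear !tnth_tupd tupd_tupd eqxx /jac; congr tupd.
by have [jk|jk] := eqVneq j k => /=; ring.
Qed.

Lemma measurable_fun_tnth d (T : measurableType d) (f : T -> N.-tuple R) j :
  measurable_fun setT f -> measurable_fun setT (fun x => tnth (f x) j).
Proof. by move/measurable_fun_tnthP; exact. Qed.

Lemma measurable_shear d (T : measurableType d) (f : T -> N.-tuple R) (g : T -> R) j :
  measurable_fun setT f -> measurable_fun setT g ->
  measurable_fun setT (fun x => shear j (g x) (f x)).
Proof.
move=> mf mg; apply: measurable_fun_tupd => //; apply: measurable_funD.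
  exact: measurable_fun_tnth.
by apply: measurable_funM => //; exact: measurable_fun_tnth.
Qed.

Lemma measurable_shear1 j t : measurable_fun setT (shear j t).
Proof. by apply: (measurable_shear (f := id) (g := cst t)). Qed.

Variable lam : {measure set (N.-tuple R) -> \bar R}.
Hypothesis lamP : is_lebesgue_tuple lam.

(** Disintegration along coordinate [j] reduces this to the affine change of variable on each
    line. *)
Lemma lebesgue_shear j t A : 0 < jac j t -> measurable A ->
  lam (shear j t @^-1` A) = ((jac j t)^-1%:E * lam A)%E.
Proof.
move=> J0 mA.
have mS : measurable [set r : N.-tuple R | 0 <= tnth r j <= 1].
  rewrite (_ : mkset _ = (tnth (T := R))^~ j @^-1` `[0, 1]%classic).
    by rewrite -[X in measurable X]setTI; apply: measurable_tnth => //; exact: measurable_itv.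
  by apply/seteqP; split => r /=; rewrite in_itv.
have msh : measurable_fun setT (shear j t).
  exact: measurable_shear1.
have msA : measurable (shear j t @^-1` A) by rewrite -[X in measurable X]setTI; exact: msh.
have mtup r : measurable_fun setT (fun u : measurableTypeR R => tupd r j u).
  by apply: measurable_fun_tupd.
have mfib r : measurable [set u : measurableTypeR R | A (tupd r j u)].
  by have := mtup r measurableT A mA; rewrite setTI.
rewrite (lebesgue_tuple_slab lamP mS msA) (lebesgue_tuple_slab lamP mS mA).
rewrite -ge0_integralZl//; last 2 first.
- pose th (q : N.-tuple R * measurableTypeR R) := tupd q.1 j q.2.
  have mth : measurable_fun setT th by apply: measurable_fun_tupd.
  have mthA : measurable (th @^-1` A) by rewrite -[X in measurable X]setTI; exact: mth.
  apply: eq_measurable_fun (measurable_fun_xsection (@lebesgue_measure R) mthA) => r _.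
  by congr (lebesgue_measure _); apply/seteqP; split => u; rewrite /xsection/= inE.
- by rewrite lee_fin invr_ge0 ltW.
apply: eq_integral => r _.
rewrite -(lebesgue_measure_affine (t * (j != k)%:R * tnth r k) J0 (mfib r)).
congr (lebesgue_measure _); apply/seteqP; split => u /=; by rewrite shear_tupd.
Qed.

Lemma ge0_integral_shear j t (u : N.-tuple R -> \bar R) : 0 < jac j t ->
  measurable_fun setT u -> (forall r, 0 <= u r)%E ->
  (\int[lam]_r u (shear j t r) = (jac j t)^-1%:E * \int[lam]_r u r)%E.
Proof.
move=> J0 mu u0.
have msh : measurable_fun setT (shear j t).
  exact: measurable_shear1.
have [pm pmE] := pushforward_measureP lam msh.
have Ji0 : 0 <= (jac j t)^-1 by rewrite invr_ge0 ltW.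
transitivity (\int[pm]_r u r)%E.
  have := @ge0_integral_pushforward _ _ _ _ R _ msh lam setT u measurableT mu (fun y _ => u0 y).
  rewrite preimage_setT => <-.
  by apply: eq_measure_integral => // A mA _; rewrite pmE.
transitivity (\int[mscale (NngNum Ji0) lam]_r u r)%E; last by rewrite ge0_integral_mscale.
apply: eq_measure_integral => A mA _; rewrite pmE.
exact: lebesgue_shear.
Qed.

Lemma measurable_pushed (u : N.-tuple R -> R) j t : measurable_fun setT u -> measurable_fun setT (pushed u j t).
Proof.
move=> mu; apply: measurable_funM => //.
apply: (measurableT_comp mu).
exact: measurable_shear1.
Qed.

Lemma pushed_shear u j t r : jac j t != 0 -> pushed u j t (shear j t r) = u r / jac j t.
Proof. by move=> J0; rewrite /pushed shearK. Qed.

Lemma ge0_integral_pushed (u : N.-tuple R -> R) j t B : 0 < jac j t ->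
  measurable_fun setT u -> (forall r, 0 <= u r) -> measurable B ->
  (\int[lam]_(r in shear j t @^-1` B) (u r)%:E = \int[lam]_(r in B) (pushed u j t r)%:E)%E.
Proof.
move=> J0 mu u0 mB.
have J0' : jac j t != 0 by rewrite gt_eqF.
rewrite integral_mkcond [RHS]integral_mkcond.
pose v := (fun r => (pushed u j t r)%:E) \_ B.
transitivity (\int[lam]_r ((jac j t)%:E * v (shear j t r)))%E.
  apply: eq_integral => r _; rewrite /v !patchE.
  have -> : (r \in shear j t @^-1` B) = (shear j t r \in B).
    by apply/idP/idP; rewrite !inE.
  case: ifPn => _; last by rewrite mule0.
  by rewrite pushed_shear// -EFinM; congr EFin; field.
have v0 r : (0 <= v r)%E.
  by rewrite /v patchE; case: ifPn => // _; rewrite lee_fin divr_ge0// ltW.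
have mv : measurable_fun setT v.
  apply/(measurable_restrictT _ mB)/measurable_EFinP.
  exact: measurable_funS (measurable_pushed j t mu).
rewrite ge0_integralZl//; last 2 first.
- apply: (measurableT_comp mv).
  exact: measurable_shear1.
- by rewrite lee_fin ltW.
by rewrite ge0_integral_shear// muleA -EFinM divff// mul1e.
Qed.

Lemma jac_inv j t : jac j t != 0 -> jac j (- t / jac j t) = (jac j t)^-1.
Proof. by rewrite /jac; case: (j == k) => J0; field; move: J0; rewrite /= ?mul1r ?mul0r ?addr0. Qed.

End shear.

Lemma measurable_fun_invr (R : realType) : measurable_fun [set: R] (@GRing.inv R).
Proof.
have -> : [set: R] = [set~ 0] `|` [set 0] by rewrite setUC setUv.
apply/measurable_funU => //; first exact: measurableC.
split; last exact: measurable_fun_set1.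
apply: open_continuous_measurable_fun; first exact/closed_openC/closed_eq.
by move=> x; rewrite inE => /eqP x0; exact: inv_continuous.
Qed.

(** Dominated convergence is about sequences; this brings its conclusions back to a punctured
    neighbourhood of [0]. If no [d] worked, a sequence of counterexamples with [|t n| < 1 / (n + 1)]
    would exist, so a single good index is enough to conclude. The bound by [1] keeps [jac]
    positive. *)
Lemma near0_of_seq (R : realType) (P : R -> Prop) :
  (forall t : R ^nat, (forall n, t n != 0 /\ `|t n| < 1) -> t n @[n --> \oo] --> 0 -> exists n, P (t n)) ->
  exists2 d, 0 < d & forall t, t != 0 -> `|t| < d -> P t.
Proof.
move=> seqP; apply: contrapT => nP.
have h n : exists t, [/\ t != 0, `|t| < n.+1%:R^-1 & ~ P t].
  apply: contrapT => nt; apply: nP; exists n.+1%:R^-1 => // t t0 tn.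
  by apply: contrapT => Pt; apply: nt; exists t.
have [t ht] := choice h.
have [] := seqP t.
- move=> n; case: (ht n) => -> /lt_le_trans tn _; split => //; apply: tn.
  by rewrite invf_le1// ler1n.
- apply/cvgrPdist_lt => e e0; near=> n; rewrite sub0r normrN.
  case: (ht n) => _ /lt_trans + _; apply.
  rewrite -[X in _ < X]invrK ltf_pV2 ?posrE ?invr_gt0//.
  near: n; apply: filterS (nbhs_infty_gtr e^-1) => m em.
  by rewrite (lt_trans em)// ltr_nat.
- by move=> n; case: (ht n).
Unshelve. all: by end_near. Qed.

(** * Convergence in mean *)

Section scheffe.
Context d (T : measurableType d) (R : realType).
Variable mu : {measure set T -> \bar R}.

(** The functions [v n = |u_ n| + |u| - |u_ n - u|] lie between [0] and [2 |u|] and tend to [2 |u|],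
    so dominated convergence sends their integrals to [2 A]. The distance is at most [a n + A] minus
    that integral. Only an upper bound on the norms of [u_ n] is required. *)
Lemma scheffe (u_ : (T -> R)^nat) (u : T -> R) (a : R^nat) (A : R) :
  (forall n, measurable_fun setT (u_ n)) ->
  mu.-integrable setT (EFin \o u) ->
  (forall x, u_ n x @[n --> \oo] --> u x) ->
  (forall n, \int[mu]_x `|u_ n x|%:E <= (a n)%:E)%E ->
  (\int[mu]_x `|u x|%:E = A%:E)%E -> a n @[n --> \oo] --> A ->
  (\int[mu]_x `|u_ n x - u x|%:E)%E @[n --> \oo] --> 0%E.
Proof.
move=> mu_ iu u_u ua uA aA.
have mu0 : measurable_fun setT u by move/integrableP : (iu) => [/measurable_EFinP].
have mnorm (h : T -> R) : measurable_fun setT h -> measurable_fun setT (fun x => `|h x|).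
  by move=> mh; exact: (measurableT_comp (@normr_measurable _ _) mh).
pose v n x := `|u_ n x| + `|u x| - `|u_ n x - u x|.
have mdiff n : measurable_fun setT (fun x => u_ n x - u x) by exact: measurable_funB.
have mv n : measurable_fun setT (v n).
  apply: measurable_funB; last exact: mnorm.
  by apply: measurable_funD; exact: mnorm.
have v0 n x : 0 <= v n x by rewrite subr_ge0 ler_normB.
have vle n x : v n x <= 2 * `|u x|.
  by rewrite /v; have := ler_normD (u_ n x - u x) (u x); rewrite subrK; lra.
have i2u : mu.-integrable setT (fun x => (2 * `|u x|)%:E).
  apply: (eq_integrable measurableT (fun x => 2%:E * (`|u x|)%:E)%E) => [x _|].
    by rewrite EFinM.
  by apply: integrableZl => //; exact: integrable_norm.
have m2u : measurable_fun setT (fun x => 2 * `|u x|).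
  by apply: measurable_funM => //; exact: mnorm.
have vbd n x : (`|(v n x)%:E| <= (2 * `|u x|)%:E)%E.
  by rewrite /= lee_fin ger0_norm.
have cuv x : (v n x)%:E @[n --> \oo] --> (2 * `|u x|)%:E.
  apply: cvg_EFin; first exact: nearW.
  have -> : 2 * `|u x| = `|u x| + `|u x| - `|u x - u x| by rewrite subrr normr0; ring.
  apply: cvgB; first by apply: cvgD; [exact: cvg_norm|exact: cvg_cst].
  by apply: cvg_norm; apply: cvgB => //; exact: cvg_cst.
have [_ _] := @dominated_convergence _ _ _ mu setT measurableT
  (fun n x => (v n x)%:E) (fun x => (2 * `|u x|)%:E) (fun x => (2 * `|u x|)%:E)
  (fun n => (measurable_EFinP _ _).2 (mv n)) ((measurable_EFinP _ _).2 m2u)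
  (aeW _ (fun x _ => cuv x)) i2u
  (aeW _ (fun x n _ => vbd n x)).
have -> : (\int[mu]_x (2 * `|u x|)%:E = (A + A)%:E)%E.
  under eq_integral do rewrite EFinM.
  rewrite ge0_integralZl//; last exact/measurable_EFinP/mnorm.
  by rewrite uA -EFinM; congr EFin; ring.
move=> cv.
have key n : (\int[mu]_x `|u_ n x - u x|%:E + \int[mu]_x (v n x)%:E <= (a n + A)%:E)%E.
  rewrite -ge0_integralD//; last 3 first.
  - exact/measurable_EFinP/mnorm.
  - by move=> x _; rewrite lee_fin.
  - exact/measurable_EFinP.
  rewrite EFinD -uA (le_trans _ (leeD2r _ (ua n)))//.
  rewrite -ge0_integralD//; last 2 first.
  - exact/measurable_EFinP/mnorm.
  - exact/measurable_EFinP/mnorm.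
  rewrite le_eqVlt; apply/orP; left; apply/eqP; apply: eq_integral => x _.
  by rewrite -!EFinD /v; congr EFin; ring.
have I0 n : (0 <= \int[mu]_x `|u_ n x - u x|%:E)%E by apply: integral_ge0.
have V0 n : (0 <= \int[mu]_x (v n x)%:E)%E by apply: integral_ge0 => x _; rewrite lee_fin.
have Vfin n : (\int[mu]_x (v n x)%:E)%E \is a fin_num.
  rewrite ge0_fin_numE// (le_lt_trans _ (ltry (a n + A)))// (le_trans _ (key n))//.
  by rewrite leeDr.
apply: (@squeeze_cvge _ _ _ _ (cst 0%E) _
  (fun n => (a n + A)%:E - \int[mu]_x (v n x)%:E)%E).
- by apply: nearW => n; rewrite I0/= leeBrDr.
- exact: cvg_cst.
- have -> : 0%E = ((A + A)%:E - (A + A)%:E)%E :> \bar R by rewrite subee.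
  apply: cvgeB => //.
  apply: cvg_EFin; first exact: nearW.
  by apply: cvgD => //; exact: cvg_cst.
Qed.

End scheffe.

(** * Differentiating the pushed density in the shear parameter *)

Section line_derivative.
Context {R : realType} {N : nat}.
Variables (f : N.-tuple R -> R) (k j : 'I_N).
Hypothesis fder : forall r, derivable (fun t => f (tupd r j t)) (tnth r j) 1.

Lemma derivable_line r x : derivable (fun t => f (tupd r j t)) x 1.
Proof.
have := @fder (tupd r j x); rewrite tnth_tupd eqxx.
by under eq_fun do rewrite tupd_tupd.
Qed.

Lemma continuous_line r : continuous (fun t => f (tupd r j t)).
Proof.
by move=> x; apply/differentiable_continuous/derivable1_diffP/derivable_line.
Qed.

Lemma Phi_tupd r x : Phi f k j (tupd r j x) =
  (j == k)%:R * f (tupd r j x) +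
  (if k == j then x else tnth r k) * derive1 (fun t => f (tupd r j t)) x.
Proof.
rewrite /Phi tnth_tupd eqxx.
under eq_fun do rewrite !tupd_tupd tnth_tupd.
have dG : is_derive x 1 (fun t => f (tupd r j t)) (derive1 (fun t => f (tupd r j t)) x).
  by rewrite derive1E; exact/derivableP/derivable_line.
rewrite [LHS]derive1E; case: (eqVneq k j) => kj.
  by rewrite (@derive_val _ _ _ _ _ _ _ (is_deriveM (is_derive_id _ _) dG)) /= /GRing.scale/=; ring.
have h := is_deriveM (is_derive_cst (tnth r k : R) x (1 : R)) dG.
by rewrite (@derive_val _ _ _ _ _ _ _ h) /GRing.scale/= /cst mulr0 addr0 mul0r add0r.
Qed.

(** The moved coordinate [y s] has derivative [- r_k / jac ^ 2]. For [j = k] the derivative of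
    [1 / jac] adds the term in [f] that completes the product rule for [r_k f]; for [j != k] the
    factor [r_k] is constant and [jac] is [1]. So [Phi] fits both cases. *)
Lemma is_derive_pushed r s : jac k j s != 0 ->
  is_derive s 1 (fun s => pushed k f j s r)
    (- (Phi f k j (shear k j (- s / jac k j s) r) / jac k j s ^+ 2)).
Proof.
move=> J0.
pose G x := f (tupd r j x).
pose y s := tnth r j - s * (jac k j s)^-1 * tnth r k.
have dG : is_derive (y s) 1 G (derive1 G (y s)).
  by rewrite derive1E; exact/derivableP/derivable_line.
have dJ : is_derive s 1 (fun s => jac k j s) (j == k)%:R.
  have -> : (fun s => jac k j s) = cst 1 + cst ((j == k)%:R : R) * id :> (R -> R) by [].
  by apply: is_derive_eq; rewrite /GRing.scale/= /cst mulr0 addr0 add0r mulr1.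
have dJi := is_deriveV J0 dJ.
have dy : is_derive s 1 y (- (tnth r k / jac k j s ^+ 2)).
  have -> : y = cst (tnth r j) - (id * (fun s => (jac k j s)^-1)) * cst (tnth r k) :> (R -> R) by [].
  apply: is_derive_eq.
  rewrite /GRing.scale/= /cst /=; move: J0; rewrite /jac => J0; field.
  exact: J0.
have dGy := is_derive1_comp dG dy.
rewrite /pushed.
have -> : (fun s => f (shear k j (- s / jac k j s) r) / jac k j s) =
    (G \o y) * (fun s => (jac k j s)^-1).
  apply/funext => u; transitivity (G (y u) / jac k j u) => //.
  by rewrite /G /y /shear !mulNr.
apply: is_derive_eq.
have -> : shear k j (- s / jac k j s) r = tupd r j (y s) by rewrite /shear /y !mulNr.
rewrite Phi_tupd -/G -/(G _) /GRing.scale/=.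
move: J0; rewrite /y /jac; have [jk|jk] := eqVneq j k => /= J0.
  by rewrite -jk; rewrite mul1r in J0 *; field.
by rewrite mul0r addr0 !divr1 !expr1n; field.
Qed.

Lemma pushed0 (u : N.-tuple R -> R) (i : 'I_N) : pushed k u i 0 = u.
Proof.
apply/funext => r; rewrite /pushed /jac mulr0 addr0 divr1 /shear oppr0 mul0r mul0r addr0.
by rewrite tupd_id.
Qed.

End line_derivative.

(** * Estimates in mean for a single shear *)

Section L1.
Context {R : realType} {N : nat}.
Notation leb := (@lebesgue_measure R).
Variables (mu : {sigma_finite_measure set (N.-tuple R) -> \bar R}) (k : 'I_N).
Hypothesis muP : is_lebesgue_tuple mu.

Lemma jac_ge (j : 'I_N) (s t : R) : `|s| <= t -> t <= 1 -> 1 - t <= jac k j s.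
Proof. by rewrite ler_norml /jac; case: (j == k) => /= /andP[? ?] ?; rewrite ?mul1r ?mul0r; lra. Qed.

Lemma jac_gt0 (j : 'I_N) (t : R) : `|t| < 1 -> 0 < jac k j t.
Proof. by move=> t1; apply: lt_le_trans (jac_ge j (lexx _) (ltW t1)); lra. Qed.

Lemma measurable_jac (j : 'I_N) : measurable_fun [set: R] (jac k j).
Proof. by apply: measurable_funD => //; exact: measurable_funM. Qed.

Section derivative.
Variables (f : N.-tuple R -> R) (j : 'I_N).
Hypothesis mf : measurable_fun setT f.
Hypothesis fder : forall r, derivable (fun t => f (tupd r j t)) (tnth r j) 1.
Hypothesis iPhi : mu.-integrable setT (fun r => (Phi f k j r)%:E).

Let mPhi : measurable_fun setT (Phi f k j).
Proof. by move/integrableP : iPhi => [/measurable_EFinP]. Qed.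

Let mnPhi : measurable_fun setT (fun r => `|Phi f k j r|).
Proof. exact: (measurableT_comp (@normr_measurable _ _) mPhi). Qed.

Lemma integral_pushed_increment t : `|t| < 1 ->
  (\int[mu]_r `|pushed k f j t r - f r|%:E <=
   (`|t| / (1 - `|t|))%:E * \int[mu]_r `|Phi f k j r|%:E)%E.
Proof.
move=> t1.
(* Ordered endpoints handle both signs of [t] together. *)
pose a := Num.min 0 t; pose b := Num.max 0 t.
have [ab ba tab] : [/\ a <= b, b - a = `|t| & forall s, s \in `[a, b] -> `|s| <= `|t|].
  rewrite /a /b; case: (leP 0 t) => t0.
    split; rewrite ?subr0 ?(ger0_norm t0)// => s; rewrite in_itv/= => /andP[s0 st].
    by rewrite ger0_norm.
  rewrite ltr0_norm// sub0r ltW//; split => // s; rewrite in_itv/= => /andP[s0 st].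
  by rewrite ler0_norm// lerN2.
have J0 s : s \in `[a, b] -> 0 < jac k j s.
  by move=> /tab st; apply: jac_gt0; exact: le_lt_trans st t1.
pose p s r : R := `|Phi f k j (shear k j (- s / jac k j s) r)| / jac k j s ^+ 2.
pose D := `[a, b]%classic : set R.
have mD : measurable D by exact: measurable_itv.
(* The cut-off by [D] makes the integrand a function on the full product, ready for Tonelli. *)
pose q (x : N.-tuple R * measurableTypeR R) : R := p x.2 x.1 * \1_D x.2.
have mJ : measurable_fun setT (fun x : N.-tuple R * measurableTypeR R => jac k j x.2).
  exact: (measurableT_comp (measurable_jac j)).
have mJi : measurable_fun setT (fun x : N.-tuple R * measurableTypeR R => (jac k j x.2)^-1).
  exact: (measurableT_comp (@measurable_fun_invr R)).
have mp : measurable_fun setT (fun x : N.-tuple R * measurableTypeR R => p x.2 x.1).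
  apply: measurable_funM.
    apply: (measurableT_comp mnPhi); apply: measurable_shear => //.
    by apply: measurable_funM => //; exact: measurableT_comp.
  under eq_fun do rewrite -exprVn.
  exact: measurable_funX.
have mq : measurable_fun setT q.
  apply: measurable_funM => //.
  have m1D : measurable_fun [set: measurableTypeR R] (\1_D : _ -> R) by exact: measurable_indic.
  exact: (measurableT_comp m1D measurable_snd).
have p0 s r : 0 <= p s r by rewrite divr_ge0// sqr_ge0.
have q0 x : 0 <= q x by rewrite mulr_ge0// indicE.
have inc r : (`|pushed k f j t r - f r|%:E <= \int[leb]_s (q (r, s))%:E)%E.
  have mpr : measurable_fun D (fun s => p s r).
    have := measurableT_comp mp (measurable_pair1 r).
    exact: measurable_funS.
  have -> : (\int[leb]_s (q (r, s))%:E = \int[leb]_(s in D) (p s r)%:E)%E.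
    rewrite [RHS]integral_mkcond; apply: eq_integral => s _.
    by rewrite patchE /q indicE; case: ifPn; rewrite ?mulr1 ?mulr0.
  pose sg s := pushed k f j s r.
  have dsg s : s \in `[a, b] -> is_derive s 1 sg
      (- (Phi f k j (shear k j (- s / jac k j s) r) / jac k j s ^+ 2)).
    by move=> sab; apply: is_derive_pushed => //; rewrite gt_eqF// J0.
  have pE s : p s r = `|Phi f k j (shear k j (- s / jac k j s) r) / jac k j s ^+ 2|.
    by rewrite normrM normfV (ger0_norm (sqr_ge0 _)).
  (* The increment bound is one-sided; applied to [sg] and to [- sg] it controls the absolute
     value. *)
  have up : ((sg b - sg a)%:E <= \int[leb]_(s in D) (p s r)%:E)%E.
    apply: increment_le_integral => // s sab; have ds := dsg s sab.
      exact: ex_derive.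
    by rewrite derive1E derive_val pE (le_trans (ler_norm _))// normrN.
  have dn : ((- sg b - - sg a)%:E <= \int[leb]_(s in D) (p s r)%:E)%E.
    apply: (@increment_le_integral _ (- sg) _ a b) => // s sab; have ds := is_deriveN (dsg s sab).
      exact: ex_derive.
    by rewrite derive1E derive_val opprK pE ler_norm.
  have -> : `|pushed k f j t r - f r| = `|sg b - sg a|.
    rewrite -{2}(pushed0 k f j) /sg /a /b; case: (leP 0 t) => // t0.
    by rewrite distrC.
  by case: (ger0P (sg b - sg a)) => // _; rewrite opprB; move: dn; rewrite opprK addrC.
have C0fin : (\int[mu]_r `|Phi f k j r|%:E)%E \is a fin_num.
  by move/integrable_norm : iPhi => h; apply: integrable_fin_num.
pose C := fine (\int[mu]_r `|Phi f k j r|%:E)%E.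
have CE : (\int[mu]_r `|Phi f k j r|%:E = C%:E)%E by rewrite fineK.
have C0 : 0 <= C by rewrite fine_ge0// integral_ge0.
rewrite CE.
apply: (@le_trans _ _ (\int[mu]_r \int[leb]_s (q (r, s))%:E)%E).
  apply: ge0_le_integral => //.
  - apply/measurable_EFinP; apply: (measurableT_comp (@normr_measurable _ _)).
    by apply: measurable_funB => //; exact: measurable_pushed.
  - apply: (measurable_fun_fubini_tonelli_F (fun x => (q x)%:E)) => //.
      exact/measurable_EFinP.
rewrite (fubini_tonelli (fun x => (q x)%:E)); last 2 first.
- exact/measurable_EFinP.
- by move=> x; rewrite lee_fin.
have t1' : 0 < 1 - `|t| by rewrite subr_gt0.
apply: (@le_trans _ _ (\int[leb]_s (((1 - `|t|)^-1 * C)%:E * (\1_D s)%:E))%E); last first.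
  rewrite ge0_integralZl_EFin//; last 2 first.
  - by apply/measurable_EFinP; exact: measurable_indic.
  - by rewrite mulr_ge0// invr_ge0 ltW.
  have -> : (\int[leb]_x (\1_D x)%:E = leb D)%E by rewrite integral_indic// setIT.
  rewrite /D lebesgue_measure_itv/= lte_fin.
  rewrite -EFinM; case: ifPn => [ab'|_].
    by rewrite -EFinB ba -EFinM lee_fin; rewrite le_eqVlt; apply/orP; left; apply/eqP; ring.
  by rewrite mule0 lee_fin !mulr_ge0// invr_ge0 ltW.
apply: ge0_le_integral => //.
- by move=> s _; apply: integral_ge0 => r _; rewrite lee_fin.
- apply: (measurable_fun_fubini_tonelli_G (fun x => (q x)%:E)) => //.
    exact/measurable_EFinP.
- by apply: measurable_funeM; apply/measurable_EFinP; exact: measurable_indic.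
move=> s _.
have [sD|sD] := boolP (s \in D); last first.
  rewrite indicE (negbTE sD) mule0 integral0_eq// => r _.
  by rewrite /q/= indicE (negbTE sD) mulr0.
rewrite indicE sD mule1.
have sab : s \in `[a, b] by move: sD; rewrite inE.
have Js := J0 s sab.
have Jn0 : jac k j s != 0 by rewrite gt_eqF.
have -> : (\int[mu]_r (q (r, s))%:E =
    \int[mu]_r ((jac k j s ^- 2)%:E * `|Phi f k j (shear k j (- s / jac k j s) r)|%:E))%E.
  by apply: eq_integral => r _; rewrite /q/= indicE sD mulr1 /p mulrC EFinM.
have mPs : measurable_fun setT (fun r => `|Phi f k j (shear k j (- s / jac k j s) r)|%:E).
  apply/measurable_EFinP; apply: (measurableT_comp mnPhi).
  exact: measurable_shear1.
rewrite ge0_integralZl_EFin//; last by rewrite invr_ge0 sqr_ge0.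
rewrite (ge0_integral_shear muP (u := fun r => `|Phi f k j r|%:E)) ?jac_inv ?invr_gt0//; last exact/measurable_EFinP.
(* The change of variable by the inverse shear gives back one factor [jac k j s], so [jac ^- 2]
   becomes [1 / jac], at most [1 / (1 - |t|)] on [[a, b]]. *)
rewrite CE invrK -!EFinM lee_fin mulrA ler_wpM2r//.
rewrite expr2 invfM mulfVK// lef_pV2 ?posrE//.
by apply: jac_ge (tab _ sab) (ltW t1).
Qed.

(** The increment bound divided by [|t|] is [C / (1 - |t|)], which tends to the norm [C] of the
    pointwise limit [- Phi f k j]: exactly the input of [scheffe]. *)
Lemma pushed_derivative_L1 e : 0 < e -> exists2 d, 0 < d & forall t, t != 0 -> `|t| < d ->
  (\int[mu]_r `|(pushed k f j t r - f r) / t + Phi f k j r|%:E <= e%:E)%E.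
Proof.
move=> e0; apply: near0_of_seq => t tP t0.
have C0fin : (\int[mu]_r `|Phi f k j r|%:E)%E \is a fin_num.
  by move/integrable_norm : iPhi => h; apply: integrable_fin_num.
pose C := fine (\int[mu]_r `|Phi f k j r|%:E)%E.
have CE : (\int[mu]_r `|Phi f k j r|%:E = C%:E)%E by rewrite fineK.
have mdiff n : measurable_fun setT (fun r => pushed k f j (t n) r - f r).
  by apply: measurable_funB => //; exact: measurable_pushed.
have : (\int[mu]_x `|(pushed k f j (t n) x - f x) / t n - - Phi f k j x|%:E)%E
    @[n --> \oo] --> 0%E.
  apply: (@scheffe _ _ R mu (fun n r => (pushed k f j (t n) r - f r) / t n)
    (fun r => - Phi f k j r) (fun n => C / (1 - `|t n|)) C) => //.
- by move=> n; exact: measurable_funM.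
- by apply: eq_integrable (integrableN iPhi) => // r _; rewrite /= EFinN.
- move=> r; have J1 : jac k j (0 : R) = 1 by rewrite /jac mulr0 addr0.
  have J0 : jac k j (0 : R) != 0 by rewrite J1 oner_eq0.
  have [dx dE] := is_derive_pushed fder r J0.
  have Dc : h^-1 *: (pushed k f j (h *: (1 : R) + 0) r - pushed k f j 0 r) @[h --> (0 : R)^'] -->
      - Phi f k j r.
    have := dx; rewrite /derivable -/(derive _ _ _) => dx'.
    have := dx' : _ --> _; rewrite -/(derive _ _ _) dE J1 expr1n divr1 oppr0 mul0r.
    by rewrite /shear mul0r addr0 tupd_id.
  have := (cvgr_dnbhsP _ _ _).1 Dc t (conj (fun n => (tP n).1) t0).
  apply: cvg_trans; apply: near_eq_cvg; apply: nearW => n /=.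
  by rewrite pushed0 /GRing.scale/= mulr1 addr0 mulrC.
- move=> n; have [tn0 tn1] := tP n.
  have := integral_pushed_increment tn1; rewrite CE => h.
  have -> : (\int[mu]_x `|(pushed k f j (t n) x - f x) / t n|%:E =
     \int[mu]_x ((`|t n|^-1)%:E * `|pushed k f j (t n) x - f x|%:E))%E.
    by apply: eq_integral => r _; rewrite normrM normfV mulrC EFinM.
  rewrite ge0_integralZl_EFin//; last first.
    by apply/measurable_EFinP; exact: (measurableT_comp (@normr_measurable _ _)).
  apply: (@le_trans _ _ ((`|t n|^-1)%:E * ((`|t n| / (1 - `|t n|))%:E * C%:E))%E).
    by rewrite lee_wpmul2l// lee_fin.
  rewrite -!EFinM lee_fin le_eqVlt; apply/orP; left; apply/eqP.
  by field; rewrite normr_eq0 tn0 andbT gt_eqF// subr_gt0.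
- by rewrite -CE; apply: eq_integral => r _; rewrite normrN.
- rewrite -[X in _ --> X]divr1; apply: cvgM; first exact: cvg_cst.
  apply: cvgV => //; rewrite -[X in _ --> X]subr0; apply: cvgB; first exact: cvg_cst.
  by rewrite [X in _ --> X](_ : 0 = `|0 : R|); [exact: cvg_norm|rewrite normr0].
move=> /fine_cvgP[fin /cvgrPdist_le/(_ e e0) cv].
near \oo => n; exists n.
have Ifin : (\int[mu]_x `|(pushed k f j (t n) x - f x) / t n - - Phi f k j x|%:E)%E \is a fin_num.
  by near: n.
rewrite (eq_integral (fun x => `|(pushed k f j (t n) x - f x) / t n - - Phi f k j x|%:E)); last first.
  by move=> r _; rewrite opprK.
rewrite -(fineK Ifin) lee_fin.
have : `|0 - fine (\int[mu]_x `|(pushed k f j (t n) x - f x) / t n - - Phi f k j x|%:E)%E| <= e.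
  by near: n; exact: cv.
by rewrite sub0r normrN; apply: le_trans; exact: ler_norm.
Unshelve. all: by end_near. Qed.

End derivative.

(** Pushing preserves the total integral of a nonnegative function, so [scheffe] applies with a
    constant bound as soon as there is pointwise convergence, which continuity along the [j]-lines
    provides. *)
Lemma pushed_continuous_L1 (u : N.-tuple R -> R) (j : 'I_N) e :
  measurable_fun setT u -> (forall r, 0 <= u r) -> mu.-integrable setT (EFin \o u) ->
  (forall r, continuous (fun x => u (tupd r j x))) -> 0 < e ->
  exists2 d, 0 < d & forall t, `|t| < d ->
    (\int[mu]_r `|pushed k u j t r - u r|%:E <= e%:E)%E.
Proof.
move=> mu_ u0 iu uc e0.
have [d d0 hd] : exists2 d, 0 < d & forall t, t != 0 -> `|t| < d ->
    (\int[mu]_r `|pushed k u j t r - u r|%:E <= e%:E)%E; last first.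
  exists d => // t td; have [->|t0] := eqVneq t 0; last exact: hd.
  rewrite pushed0 integral0_eq ?lee_fin ?ltW// => r _.
  by rewrite subrr normr0.
apply: near0_of_seq => t tP t0.
have Afin : (\int[mu]_r (u r)%:E)%E \is a fin_num by apply: integrable_fin_num.
pose A := fine (\int[mu]_r (u r)%:E)%E.
have AE : (\int[mu]_r (u r)%:E = A%:E)%E by rewrite fineK.
have : (\int[mu]_x `|pushed k u j (t n) x - u x|%:E)%E @[n --> \oo] --> 0%E.
  apply: (@scheffe _ _ R mu (fun n => pushed k u j (t n)) u (fun=> A) A) => //.
- by move=> n; exact: measurable_pushed.
- move=> r.
  have cJ : jac k j (t n) @[n --> \oo] --> (1 : R).
    rewrite -[X in _ --> X]addr0 -[X in _ --> _ + X](mulr0 (j == k)%:R).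
    by apply: cvgD; [exact: cvg_cst|apply: cvgM => //; exact: cvg_cst].
  have cJi : (jac k j (t n))^-1 @[n --> \oo] --> (1 : R).
    by rewrite -[X in _ --> X]invr1; apply: cvgV.
  rewrite -[X in _ --> X]mulr1; apply: cvgM => //.
  rewrite -[X in _ --> u X](tupd_id r j).
  have cy : tnth r j + - t n / jac k j (t n) * tnth r k @[n --> \oo] --> tnth r j.
    rewrite [X in _ --> X](_ : _ = tnth r j + - 0 * 1 * tnth r k); last by rewrite oppr0 !mul0r addr0.
    apply: cvgD; first exact: cvg_cst.
    apply: cvgM; last exact: cvg_cst.
    by apply: cvgM => //; exact: cvgN.
  exact: (cvg_comp _ _ cy (uc r (tnth r j))).
- move=> n; have [_ /(jac_gt0 j) J0] := tP n.
  rewrite -AE (eq_integral (fun r => (pushed k u j (t n) r)%:E)).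
    by rewrite -(ge0_integral_pushed muP J0 mu_ u0 measurableT) preimage_setT.
  by move=> r _; rewrite ger0_norm// divr_ge0// ltW.
- by rewrite -AE; apply: eq_integral => r _; rewrite ger0_norm.
- exact: cvg_cst.
move=> /fine_cvgP[fin /cvgrPdist_le/(_ e e0) cv].
near \oo => n; exists n.
rewrite -[leLHS]fineK; last by near: n.
rewrite lee_fin.
have : `|0 - fine (\int[mu]_x `|pushed k u j (t n) x - u x|%:E)%E| <= e.
  by near: n; exact: cv.
by rewrite sub0r normrN; apply: le_trans; exact: ler_norm.
Unshelve. all: by end_near. Qed.

End L1.

(** The bound does not depend on [B]; this is where closeness in mean becomes uniform over sets. *)
Lemma Rintegral_close d (T : measurableType d) (R : realType)
    (mu : {measure set T -> \bar R}) (u v : T -> R) (B : set T) (e : R) :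
  mu.-integrable setT (EFin \o u) -> mu.-integrable setT (EFin \o v) ->
  measurable B -> (\int[mu]_x `|u x - v x|%:E <= e%:E)%E ->
  `|\int[mu]_(x in B) u x - \int[mu]_(x in B) v x| <= e.
Proof.
move=> iu iv mB uv.
have iuB : mu.-integrable B (EFin \o u) by exact: integrableS iu.
have ivB : mu.-integrable B (EFin \o v) by exact: integrableS iv.
have iuv : mu.-integrable setT (EFin \o (fun x => u x - v x)).
  by apply: eq_integrable (integrableB measurableT iu iv) => // x _; rewrite /= EFinB.
have iuvB : mu.-integrable B (EFin \o (fun x => u x - v x)) by exact: integrableS iuv.
rewrite -RintegralB// -lee_fin EFin_normr_Rintegral//.
have /integrableP[muv _] := iuv.
have /integrableP[muvB _] := iuvB.
apply: (le_trans (le_abse_integral _ _ _)) => //.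
apply: le_trans uv.
apply: ge0_subset_integral => //.
by apply: measurableT_comp.
Qed.

(** * Composition of shears *)

Section telescope.
Context {R : realType} {N : nat}.
Variables (mu : {sigma_finite_measure set (N.-tuple R) -> \bar R}) (k : 'I_N).
Hypothesis muP : is_lebesgue_tuple mu.
Implicit Types (u f : N.-tuple R -> R) (j : 'I_N) (B : set (N.-tuple R)).

Lemma integrable_pushed u j t : `|t| < 1 -> measurable_fun setT u ->
  (forall r, 0 <= u r) -> mu.-integrable setT (EFin \o u) ->
  mu.-integrable setT (EFin \o pushed k u j t).
Proof.
move=> /(jac_gt0 k j) J0 mu_ u0 iu; apply/integrableP; split.
  by apply/measurable_EFinP; exact: measurable_pushed.
rewrite (eq_integral (fun r => (pushed k u j t r)%:E)); last first.
  by move=> r _; rewrite /= ger0_norm// divr_ge0// ltW.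
rewrite -(ge0_integral_pushed muP J0 mu_ u0 measurableT) preimage_setT.
by rewrite -ge0_fin_numE ?integral_ge0//; [exact: integrable_fin_num|move=> r _; rewrite lee_fin].
Qed.

Lemma Rintegral_pushed u j t B : `|t| < 1 -> measurable_fun setT u ->
  (forall r, 0 <= u r) -> measurable B ->
  \int[mu]_(r in shear k j t @^-1` B) u r = \int[mu]_(r in B) pushed k u j t r.
Proof.
by move=> /(jac_gt0 k j) J0 mu_ u0 mB; rewrite /Rintegral ge0_integral_pushed.
Qed.

(** The head of [s] acts first, so the preimage of [B] under [j :: s] is the preimage by one shear
    of the set left by the tail. The order matters: a shear along [k] changes the coordinate that
    all the others read. *)
Definition shears (s : seq 'I_N) (tau : 'I_N -> R) (r : N.-tuple R) :=
  foldl (fun r j => shear k j (tau j) r) r s.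

Lemma measurable_shears s tau : measurable_fun setT (shears s tau).
Proof.
elim: s => [|j s ih]; first exact: measurable_id.
exact: (measurableT_comp ih (measurable_shear1 _ _ _)).
Qed.

Lemma measurable_preimage_shears s tau B : measurable B ->
  measurable (shears s tau @^-1` B).
Proof. by move=> mB; rewrite -[X in measurable X]setTI; exact: measurable_shears. Qed.

Lemma shears_continuous u (s : seq 'I_N) : measurable_fun setT u ->
  (forall r, 0 <= u r) -> mu.-integrable setT (EFin \o u) ->
  (forall j, j \in s -> forall r, continuous (fun x => u (tupd r j x))) ->
  forall e, 0 < e -> exists2 d, 0 < d &
  forall tau : 'I_N -> R, (forall j, `|tau j| < d) -> forall B, measurable B ->
    `|\int[mu]_(r in shears s tau @^-1` B) u r - \int[mu]_(r in B) u r| <= e.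
Proof.
move=> mu_ u0 iu; elim: s => [|j s ih] uc e e0.
  by exists 1 => // tau _ B mB; rewrite subrr normr0 ltW.
have e20 : 0 < e / 2 by rewrite divr_gt0.
have [i hi|d1 d10 h1] := ih _ _ e20; first by apply: uc; rewrite inE hi orbT.
have [d2 d20 h2] := pushed_continuous_L1 k muP mu_ u0 iu (uc j (mem_head _ _)) e20.
exists (Num.min 1 (Num.min d1 d2)); first by rewrite !lt_min ltr01 d10.
move=> tau taud B mB.
have tau1 i : `|tau i| < 1 by have := taud i; rewrite lt_min => /andP[].
have taud1 i : `|tau i| < d1 by have := taud i; rewrite !lt_min => /and3P[].
have taud2 i : `|tau i| < d2 by have := taud i; rewrite !lt_min => /and3P[].
have mC := measurable_preimage_shears s tau mB.
have := h1 tau taud1 B mB.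
have -> : shears (j :: s) tau @^-1` B = shear k j (tau j) @^-1` (shears s tau @^-1` B) by [].
rewrite Rintegral_pushed//.
have := Rintegral_close (integrable_pushed j (tau1 j) mu_ u0 iu) iu mC (h2 _ (taud2 j)).
set x := Rintegral _ _ _; set y := Rintegral _ _ _; set z := Rintegral _ _ _.
move=> xy yz; rewrite -(subrK y x) -addrA (le_trans (ler_normD _ _))//.
by rewrite [leRHS]splitr lerD.
Qed.

Section density.
Variable f : N.-tuple R -> R.
Hypothesis mf : measurable_fun setT f.
Hypothesis f0 : forall r, 0 <= f r.
Hypothesis intf : mu.-integrable setT (EFin \o f).

Let differentiable_along j :=
  (forall r, derivable (fun t => f (tupd r j t)) (tnth r j) 1) /\
  mu.-integrable setT (fun r => (Phi f k j r)%:E).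

Lemma pushed_derivative j e : differentiable_along j -> 0 < e ->
  exists2 d, 0 < d <= 1 & forall t, t != 0 -> `|t| < d -> forall B, measurable B ->
  `|(\int[mu]_(r in B) pushed k f j t r - \int[mu]_(r in B) f r) / t +
    \int[mu]_(r in B) Phi f k j r| <= e.
Proof.
move=> [fder iPhi] e0.
have [d d0 hd] := pushed_derivative_L1 muP mf fder iPhi e0.
exists (Num.min d 1); first by rewrite lt_min d0 ltr01 ge_min lexx orbT.
move=> t t0; rewrite lt_min => /andP[td t1] B mB.
have ip := integrable_pushed j t1 mf f0 intf.
have ipf : mu.-integrable setT (EFin \o (fun r => pushed k f j t r - f r)).
  by apply: eq_integrable (integrableB measurableT ip intf) => // x _; rewrite /= EFinB.
have ipft : mu.-integrable setT (EFin \o (fun r => (pushed k f j t r - f r) / t)).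
  apply: eq_integrable (integrableZl measurableT t^-1 ipf) => // x _.
  by rewrite /= -EFinM mulrC.
have iNPhi : mu.-integrable setT (EFin \o (fun r => - 1 * Phi f k j r)).
  exact: eq_integrable (integrableZl measurableT (- 1) iPhi).
have := @Rintegral_close _ _ R mu _ _ B e ipft iNPhi mB.
rewrite RintegralZr//; last exact: integrableS ipf.
rewrite RintegralZl//; last exact: integrableS iPhi.
rewrite RintegralB//; [|exact: integrableS ip|exact: integrableS intf].
rewrite mulN1r opprK; apply.
under eq_integral do rewrite mulN1r opprK.
exact: hd.
Qed.

(* [- Phi f k j] is the L^1 limit of the quotients [(pushed k f j t - f) / t],
   which are continuous along every coordinate other than [j] and [k]; this is
   why the shear along [k] has to be applied first. *)
Lemma Phi_shears_continuous j s : differentiable_along j ->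
  (forall i, i \in s -> differentiable_along i) -> j \notin s -> k \notin s ->
  forall e, 0 < e -> exists2 d, 0 < d &
  forall tau : 'I_N -> R, (forall j, `|tau j| < d) -> forall B, measurable B ->
    `|\int[mu]_(r in shears s tau @^-1` B) Phi f k j r - \int[mu]_(r in B) Phi f k j r| <= e.
Proof.
move=> fj fs js ks e e0.
have e40 : 0 < e / 4 by rewrite divr_gt0.
have [d /andP[d0 d1] hd] := pushed_derivative fj e40.
pose t := d / 2.
have t0 : 0 < t by rewrite divr_gt0.
have td : `|t| < d by rewrite gtr0_norm// /t; lra.
have t1 : `|t| < 1 by apply: lt_le_trans td d1.
have ct i r : i \in s -> continuous (fun x => f (tupd r i x)).
  by move=> /fs[fi _]; exact: continuous_line.
have cpt i : i \in s -> forall r, continuous (fun x => pushed k f j t (tupd r i x)).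
  move=> hi r x.
  have ij : i != j by apply: contraNneq js => <-.
  have ik : i != k by apply: contraNneq ks => <-.
  have -> : (fun x => pushed k f j t (tupd r i x)) =
      (fun x => f (tupd (shear k j (- t / jac k j t) r) i x) / jac k j t).
    apply/funext => y; rewrite /pushed /shear !tnth_tupd.
    by rewrite !(eq_sym _ i) (negbTE ij) (negbTE ik) tupdC.
  by apply: cvgM; [exact: ct|exact: cvg_cst].
have ip := integrable_pushed j t1 mf f0 intf.
have mp := measurable_pushed k j t mf.
have p0 r : 0 <= pushed k f j t r by rewrite divr_ge0// ltW// jac_gt0.
(* Since [t] is now fixed, the tolerance may depend on it: two errors [e * t / 8] divided by [t]
   give [e / 4], added to the two errors [e / 4] made by replacing [Phi] with the quotient. *)
have et0 : 0 < e * t / 8 by rewrite divr_gt0// mulr_gt0.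
have [d2 d20 h2] := shears_continuous mp p0 ip cpt et0.
have [d3 d30 h3] := shears_continuous mf f0 intf (fun i hi r => ct i r hi) et0.
exists (Num.min d2 d3); first by rewrite lt_min d20.
move=> tau taud B mB.
have taud2 i : `|tau i| < d2 by have := taud i; rewrite !lt_min => /andP[].
have taud3 i : `|tau i| < d3 by have := taud i; rewrite !lt_min => /andP[].
have mC := measurable_preimage_shears s tau mB.
have := h2 tau taud2 B mB; have := h3 tau taud3 B mB.
have := hd t (lt0r_neq0 t0) td _ mB; have := hd t (lt0r_neq0 t0) td _ mC.
set x1 := Rintegral _ _ _; set x2 := Rintegral _ _ _; set x3 := Rintegral _ _ _.
set y1 := Rintegral _ _ _; set y2 := Rintegral _ _ _; set y3 := Rintegral _ _ _.
rewrite !ler_norml => /andP[a1 a2] /andP[b1 b2] /andP[c1 c2] /andP[c3 c4].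
have q1 : (x1 - x2) / t - (y1 - y2) / t <= e / 4.
  rewrite -mulrBl ler_pdivrMr//; lra.
have q2 : - (e / 4) <= (x1 - x2) / t - (y1 - y2) / t.
  rewrite -mulrBl ler_pdivlMr//; lra.
by apply/andP; split; lra.
Qed.

(** With [C] the preimage of [B] under the tail, the increment splits into the first shear over [C]
    and the tail over [B]. The former yields [Phi] integrated over [C]; [Phi_shears_continuous]
    trades [C] for [B], and each of these two steps costs [e / 2 * |tau j|]. *)
Lemma shears_expansion s : (forall j, j \in s -> differentiable_along j) ->
  uniq s -> k \notin behead s -> forall e, 0 < e -> exists2 d, 0 < d &
  forall tau : 'I_N -> R, (forall j, `|tau j| < d) -> forall B, measurable B ->
    `|\int[mu]_(r in shears s tau @^-1` B) f r - \int[mu]_(r in B) f r +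
      \sum_(j <- s) tau j * \int[mu]_(r in B) Phi f k j r| <=
    e * \sum_(j <- s) `|tau j|.
Proof.
elim: s => [|j s ih] fs us ks e e0.
  by exists 1 => // tau _ B mB; rewrite !big_nil mulr0 subrr addr0 normr0.
have fs' i : i \in s -> differentiable_along i by move=> hi; apply: fs; rewrite inE hi orbT.
have fj := fs j (mem_head _ _).
move: us => /= /andP[js us].
have ks' : k \notin behead s by apply: contra ks; exact: mem_behead.
have e20 : 0 < e / 2 by rewrite divr_gt0.
have [d1 d10 h1] := ih fs' us ks' e e0.
have [d2 /andP[d20 d21] h2] := pushed_derivative fj e20.
have [d3 d30 h3] := Phi_shears_continuous fj fs' js ks e20.
exists (Num.min d1 (Num.min d2 d3)); first by rewrite !lt_min d10 d20.
move=> tau taud B mB.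
have taud1 i : `|tau i| < d1 by have := taud i; rewrite !lt_min => /and3P[].
have taud2 i : `|tau i| < d2 by have := taud i; rewrite !lt_min => /and3P[].
have taud3 i : `|tau i| < d3 by have := taud i; rewrite !lt_min => /and3P[].
have tau1 : `|tau j| < 1 by apply: lt_le_trans d21.
have mC := measurable_preimage_shears s tau mB.
have := h1 tau taud1 B mB.
rewrite !big_cons.
have -> : shears (j :: s) tau @^-1` B = shear k j (tau j) @^-1` (shears s tau @^-1` B) by [].
rewrite Rintegral_pushed//.
have := h3 tau taud3 B mB.
set PC := Rintegral _ _ _; set PB := Rintegral _ _ _; set fC := Rintegral _ _ _.
set fB := Rintegral _ _ _; set pC := Rintegral _ _ _; set S := \sum_(j <- s) _ ; set S' := \sum_(j <- s) _.
move=> hP hs.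
have hp : `|pC - fC + tau j * PC| <= e / 2 * `|tau j|.
  (* The quotient estimate excludes the parameter [0], where nothing moves. *)
  have [t0|t0] := eqVneq (tau j) 0.
    by rewrite /pC t0 pushed0 subrr mul0r addr0 normr0 mulr0.
  have := h2 _ t0 (taud2 j) _ mC; rewrite -/PC -/fC -/pC => h.
  have -> : pC - fC + tau j * PC = ((pC - fC) / tau j + PC) * tau j by field.
  by rewrite normrM ler_wpM2r.
have hP' : `|tau j * (PB - PC)| <= e / 2 * `|tau j|.
  by rewrite normrM mulrC distrC ler_wpM2r.
have -> : pC - fB + (tau j * PB + S) =
  (pC - fC + tau j * PC) + tau j * (PB - PC) + (fC - fB + S) by ring.
apply: le_trans (ler_normD _ _) _; rewrite [leRHS]mulrDr; apply: lerD => //.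
apply: le_trans (ler_normD _ _) _.
have -> : e * `|tau j| = e / 2 * `|tau j| + e / 2 * `|tau j| by field.
exact: lerD.
Qed.

End density.
End telescope.

(** * Row vectors *)

Section rV.
Context {R : realType} {n : nat}.

(** An open set is a countable union of balls with rational centres and radii [1 / (m + 1)]. The
    norm is the maximum norm, so membership in a ball is a finite conjunction of conditions on
    coordinates. *)
Lemma measurable_preimage_open d (T : measurableType d) (F : T -> 'rV[R]_n) (U : set 'rV[R]_n) :
  (forall l, measurable_fun setT (fun x => F x 0 l)) -> open U ->
  measurable (F @^-1` U).
Proof.
move=> mF oU.
pose V (p : 'rV[rat]_n * nat) : set 'rV[R]_n :=
  ball (map_mx ratr p.1 : 'rV[R]_n) p.2.+1%:R^-1.
have -> : F @^-1` U = \bigcup_p (if `[< V p `<=` U >] then F @^-1` (V p) else set0).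
  apply/seteqP; split => [x Ux|x [p _]]; last first.
    by case: asboolP => // VU; exact: VU.
  have /nbhs_ballP[e /= e0 eU] : nbhs (F x) U by exact: open_nbhs_nbhs.
  (* This makes the radius at most [e / 2]: a ball whose centre is that close to [F x] stays in the
     ball of radius [e] around it. *)
  pose m := Num.truncn (2 / e); pose r : R := m.+1%:R^-1.
  have r0 : 0 < r by rewrite invr_gt0.
  have re : r <= e / 2.
    by rewrite -[leRHS]invrK lef_pV2 ?posrE ?invr_gt0 ?divr_gt0// invf_div ltW// truncnS_gt.
  have rat_r l : exists q : rat, ratr q \in `](F x 0 l - r), (F x 0 l + r)[.
    by apply: rat_in_itvoo; lra.
  have [c cP] := choice rat_r.
  have cr i l : ball ((map_mx ratr (\row_l c l) : 'rV[R]_n) i l) r (F x i l).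
    rewrite !mxE ord1 ball_itv /= in_itv/=.
    by have := cP l; rewrite in_itv/= => /andP[h1 h2]; apply/andP; split; lra.
  exists (\row_l c l, m) => //.
  rewrite asboolT; first by split => //.
  move=> y [_ hy]; apply: eU; split => // i l.
  rewrite (splitr e); apply: (@ball_triangle _ _ ((map_mx ratr (\row_l c l) : 'rV[R]_n) i l)).
    by apply: (le_ball re); apply: ball_sym; exact: cr.
  by apply: (le_ball re); exact: hy.
apply: countable_bigcupT_measurable; first exact: countableP.
move=> p; case: asboolP => // _.
rewrite (_ : _ @^-1` _ = \bigcap_(l in [set: 'I_n])
    ((fun x => F x 0 l) @^-1` (ball ((map_mx ratr p.1 : 'rV[R]_n) 0 l) p.2.+1%:R^-1))); last first.
  apply/seteqP; split => [x [_ h] l _|x h]; first exact: h.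
  split => [|i l]; first by rewrite invr_gt0.
  by rewrite ord1; exact: h.
apply: fin_bigcap_measurable; first exact: finite_finset.
move=> l _; rewrite -[X in measurable X]setTI; apply: mF => //.
by rewrite ball_itv; exact: measurable_itv.
Qed.

Lemma measurable_preimage_borel d (T : measurableType d) (F : T -> 'rV[R]_n) (Q : set 'rV[R]_n) :
  (forall l, measurable_fun setT (fun x => F x 0 l)) ->
  <<s [set: 'rV[R]_n], open >> Q -> measurable (F @^-1` Q).
Proof.
move=> mF; suff sub : <<s [set: 'rV[R]_n], open >> `<=` [set A | measurable (F @^-1` A)] by exact: sub.
apply: smallest_sub.
  split => /= [|A mA|A mA].
  - by rewrite preimage_set0.
  - by rewrite setTD preimage_setC; exact: measurableC.
  - by rewrite preimage_bigcup; exact: bigcupT_measurable.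
by move=> U oU; exact: measurable_preimage_open.
Qed.

Lemma ler_norm_entry (v : 'rV[R]_n) l : `|v 0 l| <= `|v|.
Proof.
rewrite [leRHS]/Num.Def.normr /= mx_normrE; apply/bigmax_geP; right => /=.
by exists (0, l).
Qed.

(** The linear form with coefficients [g] is bounded, hence continuous, and [diff_unique] identifies
    it with the differential. *)
Lemma differentiable_of_expansion (h : 'rV[R]_n -> R) (a : 'rV[R]_n) (g : 'I_n -> R) :
  (forall e, 0 < e -> exists2 d, 0 < d & forall v : 'rV[R]_n, `|v| < d ->
     `|h (a + v) - h a - \sum_l v 0 l * g l| <= e * `|v|) ->
  differentiable h a /\ forall v, 'D_v h a = \sum_l v 0 l * g l.
Proof.
move=> hexp.
pose Lf (v : 'rV[R]_n) : R^o := \sum_l v 0 l * g l.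
have linL : linear Lf.
  move=> c u v; rewrite /Lf scaler_sumr -big_split; apply: eq_bigr => l _.
  by rewrite !mxE /= mulrDl /GRing.scale/= mulrA.
pose L : {linear 'rV[R]_n -> R^o} := HB.pack Lf (GRing.isLinear.Build R 'rV[R]_n R^o *:%R Lf linL).
pose K := 1 + \sum_l `|g l|.
have K0 : 0 < K by rewrite ltr_pwDl// sumr_ge0.
have LK v : `|Lf v| <= K * `|v|.
  rewrite /K mulrDl mul1r (@le_trans _ _ ((\sum_l `|g l|) * `|v|)) ?lerDr//.
  rewrite mulr_suml (le_trans (ler_norm_sum _ _ _))// ler_sum// => l _.
  by rewrite normrM mulrC ler_wpM2l// ler_norm_entry.
have cL : continuous L.
  apply/linear_bounded_continuous; exists K; split; first exact: num_real.
  move=> M KM; apply/nbhs_ballP; exists 1 => //= v.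
  rewrite mx_norm_ball /ball_/= sub0r normrN => v1.
  by rewrite (le_trans (LK v))// (le_trans _ (ltW KM))// ler_piMr// ltW.
pose H : 'rV[R]_n -> R^o := h.
have exp : H \o shift a = cst (H a) + (L : 'rV[R]_n -> R^o) +o_ (0 : 'rV[R]_n) id.
  apply/eqaddoP => e e0.
  have [d d0 hd] := hexp e e0.
  apply/nbhs_ballP; exists d => //= v.
  rewrite mx_norm_ball /ball_/= sub0r normrN => vd.
  have E : h (v + a) - (h a + Lf v) = h (a + v) - h a - \sum_l v 0 l * g l.
    by rewrite (addrC v a) opprD addrA.
  by have := hd v vd; rewrite -E; exact.
have dE := diff_unique cL exp.
have dh : differentiable h a.
  by apply/diff_locallyP; rewrite dE.
by split => // v; rewrite deriveE// dE.
Qed.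

End rV.

Section sigma_finite_measure_of.
Context d (T : measurableType d) (R : realType).
Variables (m : {measure set T -> \bar R}) (sm : sigma_finite setT m).

(** Tonelli's theorem wants sigma-finiteness as part of the structure, while [lam] is a bare
    measure. The alias carries the proof [sm] as an argument so that the instance can be attached to
    it. *)
Definition sigma_finite_measure_of of sigma_finite setT m : set T -> \bar R := m.

HB.instance Definition _ := Measure.on (sigma_finite_measure_of sm).

HB.instance Definition _ := Measure_isSigmaFinite.Build d T R (sigma_finite_measure_of sm) sm.

End sigma_finite_measure_of.

Lemma sigma_finite_measureP d (T : measurableType d) (R : realType)
    (m : {measure set T -> \bar R}) : sigma_finite setT m ->
  exists mu : {sigma_finite_measure set T -> \bar R}, mu = m :> {measure set T -> \bar R}.
Proof. by move=> sm; exists (sigma_finite_measure_of sm); case: m sm => m []. Qed.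

(** * From shear parameters to the coordinates of the increment *)

Section affine_expansion.
Context {R : realType} {N : nat}.
Variable k : 'I_N.
Implicit Types (s : seq 'I_N) (c tau : 'I_N -> R) (r : N.-tuple R).

Lemma tnth_shears s tau r i : uniq s -> k \notin s ->
  tnth (shears k s tau r) i = tnth r i + (i \in s)%:R * tau i * tnth r k.
Proof.
elim: s r => [|j s ih] r /=; first by rewrite !mul0r addr0.
move=> /andP[js us]; rewrite inE negb_or => /andP[kj ks].
rewrite [shears _ _ _ _]/(shears k s tau (shear k j (tau j) r)) ih//.
rewrite /shear !tnth_tupd (negbTE kj) inE.
by case: eqVneq => [->|ij] /=; rewrite ?(negbTE js) ?mul0r ?mul1r ?addr0.
Qed.

(* When [k] comes first in [s], its coordinate is rescaled by [1 + c k] before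
   the other shears act; the remaining parameters compensate for that. *)
Definition shear_param c i : R := if i == k then c k else c i / (1 + c k).

Lemma tnth_shears_param s c r i : uniq s -> k \notin behead s ->
  (forall i, i \notin s -> c i = 0) -> 1 + c k != 0 ->
  tnth (shears k s (shear_param c) r) i = tnth r i + c i * tnth r k.
Proof.
case: s => [|j s] /= us ks c0 ck; first by rewrite c0// mul0r addr0.
move: us => /andP[js us].
rewrite [shears _ _ _ _]/(shears k s (shear_param c) (shear k j (shear_param c j) r)).
rewrite tnth_shears// /shear !tnth_tupd /shear_param.
have [jk|jk] := eqVneq j k.
  rewrite jk; have [->|ik] := eqVneq i k.
    by rewrite (negbTE ks) !mul0r addr0 .
  have [is_|is_] := boolP (i \in s); first by rewrite mul1r; field.
  by rewrite !mul0r addr0 c0 ?mul0r ?addr0// inE negb_or jk ik.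
(* If [k] is not the head it does not occur at all, so the division in [shear_param] is by [1]. *)
have ck0 : c k = 0 by apply: c0; rewrite inE negb_or eq_sym jk.
rewrite ck0 addr0 !divr1.
have [->|ij] := eqVneq i j; first by rewrite (negbTE js) !mul0r addr0.
have [->|ik] := eqVneq i k; first by rewrite ck0 mulr0.
have [is_|is_] := boolP (i \in s); first by rewrite mul1r.
by rewrite !mul0r c0 ?mul0r// inE negb_or ij.
Qed.

Variable mu : {sigma_finite_measure set (N.-tuple R) -> \bar R}.
Hypothesis muP : is_lebesgue_tuple mu.

(** The shear parameters differ from [c] by at most [2 |c i| |c k|], a second-order quantity, so [c]
    may replace them in the linear term. *)
Lemma affine_expansion (f : N.-tuple R -> R) s (B : set (N.-tuple R)) :
  measurable_fun setT f -> (forall r, 0 <= f r) -> mu.-integrable setT (EFin \o f) ->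
  (forall j, j \in s ->
     (forall r, derivable (fun t => f (tupd r j t)) (tnth r j) 1) /\
     mu.-integrable setT (fun r => (Phi f k j r)%:E)) ->
  uniq s -> k \notin behead s -> measurable B ->
  forall e, 0 < e -> exists2 d, 0 < d <= 1 / 2 &
  forall c, (forall i, `|c i| < d) ->
    `|\int[mu]_(r in shears k s (shear_param c) @^-1` B) f r - \int[mu]_(r in B) f r +
      \sum_(i <- s) c i * \int[mu]_(r in B) Phi f k i r| <= e * \sum_(i <- s) `|c i|.
Proof.
move=> mf f0 intf fs us ks mB e e0.
pose m i := \int[mu]_(r in B) Phi f k i r.
pose M := \sum_(i <- s) `|m i|.
have M0 : 0 <= M by rewrite sumr_ge0.
have e40 : 0 < e / 4 by rewrite divr_gt0.
have [d1 d10 h1] := shears_expansion muP mf f0 intf fs us ks e40.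
have M1 : 0 < 4 * (M + 1) by rewrite mulr_gt0// ltr_wpDl.
(* The three bounds give [1 + c k > 1 / 2], parameters below [d1], and [|c k| |m i| <= e / 4]. With
   parameters at most [2 |c i|], the expansion and the replacement each cost [e / 2] times the sum
   of the [|c i|]. *)
pose d := Num.min (1 / 2) (Num.min (d1 / 2) (e / (4 * (M + 1)))).
exists d; first by rewrite !lt_min ge_min lexx !divr_gt0.
move=> c cd.
have cd1 i : `|c i| < 1 / 2 by have := cd i; rewrite !lt_min => /and3P[].
have cd2 i : `|c i| < d1 / 2 by have := cd i; rewrite !lt_min => /and3P[].
have cd3 i : `|c i| < e / (4 * (M + 1)) by have := cd i; rewrite !lt_min => /and3P[].
have ck : 1 / 2 < 1 + c k by have := cd1 k; rewrite ltr_norml => /andP[]; lra.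
have ck0 : 0 < 1 + c k by lra.
have tauc i : `|shear_param c i| <= 2 * `|c i|.
  rewrite /shear_param; case: eqP => [->|_].
    by have := normr_ge0 (c k); lra.
  rewrite normrM normfV (gtr0_norm ck0) ler_pdivrMr//.
  have := normr_ge0 (c i); nra.
have taud i : `|shear_param c i - c i| <= 2 * `|c i| * `|c k|.
  rewrite /shear_param; case: eqP => [->|_].
    by rewrite subrr normr0 !mulr_ge0.
  have -> : c i / (1 + c k) - c i = - (c i * c k) / (1 + c k).
    by field; rewrite gt_eqF.
  rewrite normrM normrN normfV (gtr0_norm ck0) ler_pdivrMr// normrM.
  have : 0 <= `|c i| * `|c k| by rewrite mulr_ge0.
  nra.
have := h1 (shear_param c) (fun j => le_lt_trans (tauc j) _) B mB.
have tau1 j : 2 * `|c j| < d1 by have := cd2 j; lra.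
move=> /(_ tau1).
set X := _ - _; set C := \sum_(i <- s) `|c i|.
set S1 := \sum_(i <- s) _; set S2 := \sum_(i <- s) _; set S3 := \sum_(i <- s) _ => hX.
have C0 : 0 <= C by rewrite sumr_ge0.
have S2C : S2 <= 2 * C by rewrite /S2 /C mulr_sumr ler_sum.
have S13 : `|S3 - S1| <= e / 2 * C.
  rewrite /S3 /S1 -sumrB (le_trans (ler_norm_sum _ _ _))//.
  rewrite /C mulr_sumr big_seq [leRHS]big_seq ler_sum// => i is_.
  rewrite -mulrBl normrM distrC.
  have mi : `|m i| <= M.
    by rewrite /M (big_rem i is_)/= lerDl sumr_ge0.
  have h2 : `|c k| * `|m i| <= e / 4.
    apply: (@le_trans _ _ (e / (4 * (M + 1)) * (M + 1))).
      by apply: ler_pM => //; [exact: ltW|lra].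
    rewrite le_eqVlt; apply/orP; left; apply/eqP; field.
    by rewrite gt_eqF// ltr_wpDl.
  apply: (@le_trans _ _ (2 * `|c i| * `|c k| * `|m i|)).
    by rewrite ler_wpM2r.
  have := normr_ge0 (c i); nra.
have -> : X + S3 = (X + S1) + (S3 - S1) by ring.
apply: le_trans (ler_normD _ _) _.
apply: (@le_trans _ _ (e / 4 * S2 + e / 2 * C)); first exact: lerD.
nra.
Qed.

End affine_expansion.

(** * Dual bases and the gradient formula *)

Lemma inner_sumr (R : realType) (n : nat) (I : finType) (u : 'rV[R]_n) (a : I -> R)
    (z : I -> 'rV[R]_n) : inner u (\sum_i a i *: z i) = \sum_i a i * inner u (z i).
Proof.
rewrite /inner; under [RHS]eq_bigr do rewrite mulr_sumr.
rewrite exchange_big; apply: eq_bigr => l _ /=.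
rewrite summxE mulr_sumr; apply: eq_bigr => i _.
by rewrite mxE mulrCA.
Qed.

Lemma innerC (R : realType) (n : nat) (u v : 'rV[R]_n) : inner u v = inner v u.
Proof. by apply: eq_bigr => l _; rewrite mulrC. Qed.

Lemma dual_basis_expansion (R : realType) (n : nat) (z e : 'I_n -> 'rV[R]_n) :
  basis_of fullv [seq z i | i <- enum 'I_n] ->
  (forall i l, inner (e i) (z l) = (i == l)%:R) ->
  forall v, v = \sum_j inner (e j) v *: z j.
Proof.
move=> bz dual v.
pose X := [tuple z i | i < n].
have XE : [seq z i | i <- enum 'I_n] = X :> seq _ by [].
have vX : v \in <<X>>%VS by move: bz; rewrite XE => /andP[/eqP -> _]; exact: memvf.
have vE : v = \sum_j coord X j v *: z j.
  by rewrite {1}(coord_span vX); apply: eq_bigr => j _; rewrite -tnth_nth tnth_mktuple.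
rewrite {1}vE; apply: eq_bigr => j _; congr (_ *: _).
rewrite [in RHS]vE inner_sumr (bigD1 j)//= dual eqxx mulr1 big1 ?addr0// => i ij.
by rewrite dual eq_sym (negbTE ij) mulr0.
Qed.

Theorem theorem2 (R : realType) (T : measurableType default_measure_display)
  (P : probability T R) (N n : nat) (hNn : (n <= N)%N)
  (lam : {measure set (N.-tuple R) -> \bar R})
  (xi : T -> N.-tuple R) (f : N.-tuple R -> R)
  (Q : set 'rV[R]_n) (k : 'I_N) (Z : 'I_N -> 'rV[R]_n)
  (e : 'I_n -> 'rV[R]_n) :
  is_lebesgue_tuple lam ->
  has_density lam P xi f ->
  <<s [set: 'rV[R]_n], open >> Q ->
  basis_of fullv [seq Z (widen_ord hNn i) | i <- enum 'I_n] ->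
  (forall i l : 'I_n, inner (e i) (Z (widen_ord hNn l)) = (i == l)%:R) ->
  (forall (j : 'I_n) (r : N.-tuple R),
      derivable (fun t => f (tupd r (widen_ord hNn j) t))
                (tnth r (widen_ord hNn j)) 1) ->
  (forall j : 'I_n,
      lam.-integrable setT (fun r => (Phi f k (widen_ord hNn j) r)%:E)) ->
  differentiable (hk P xi Q Z k) (Z k) /\
  gradient (hk P xi Q Z k) (Z k) =
    \sum_(j < n) \sum_(i < n)
      ('D_(Z (widen_ord hNn j)) (hk P xi Q Z k) (Z k) * inner (e j) (e i))
        *: Z (widen_ord hNn i).
Proof.
move=> lamP0 [mxi mf f0 Pxi] QB basisZ dualZ fder iPhi.
have [mu muE] := sigma_finite_measureP (lebesgue_tuple_sigma_finite lamP0).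
subst lam; have muP := lamP0.
pose w := widen_ord hNn.
have winj : injective w by move=> i j /(congr1 val) /= ij; exact: val_inj.
have intf : mu.-integrable setT (EFin \o f).
  apply/integrableP; split; first exact/measurable_EFinP.
  rewrite (eq_integral (fun r => (f r)%:E)) => [|r _]; last by rewrite /= ger0_norm.
  by rewrite -Pxi// preimage_setT probability_setT ltry.
have dec v : v = \sum_j inner (e j) v *: Z (w j) := dual_basis_expansion basisZ dualZ v.
pose s0 := [seq w j | j <- enum 'I_n].
(* Only the indices of basis vectors are sheared. If [k] is one of them it goes first, as the
   expansion requires. *)
pose s := if k \in s0 then k :: rem k s0 else s0.
have us0 : uniq s0 by rewrite map_inj_uniq// enum_uniq.
have ss0 : perm_eq s s0 by rewrite /s; case: ifP => // ?; rewrite perm_sym perm_to_rem.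
have us : uniq s by rewrite (perm_uniq ss0).
have ks : k \notin behead s.
  rewrite /s; case: ifPn => /= [_|]; first by rewrite mem_rem_uniq// inE eqxx.
  by apply: contra; exact: mem_behead.
have sP i : (i \in s) -> exists j, i = w j.
  by rewrite (perm_mem ss0) => /mapP[j _ ->]; exists j.
have ws j : w j \in s by rewrite (perm_mem ss0) map_f// mem_enum.
have big_s (F : 'I_N -> R) : \sum_(i <- s) F i = \sum_j F (w j).
  by rewrite (perm_big _ ss0)/= big_map big_enum.
pose B := [set r : N.-tuple R | Q (\sum_(i < N) tnth r i *: Z i)].
have mB : measurable B.
  apply: (measurable_preimage_borel (F := fun r : N.-tuple R => \sum_(i < N) tnth r i *: Z i)) QB => l.
  under eq_fun do rewrite summxE.
  apply: measurable_sum => i; under eq_fun do rewrite mxE.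
  by apply: measurable_funM => //; exact: measurable_tnth.
(* By injectivity of [w] the sum has at most one term: the coordinate of [v] on [Z i] when [i] is a
   basis index, and [0] otherwise. *)
pose c v i := \sum_(j < n | w j == i) inner (e j) v.
have cw v j : c v (w j) = inner (e j) v.
  by rewrite /c (big_pred1 j)// => i; rewrite (inj_eq winj).
have c0 v i : i \notin s -> c v i = 0.
  by move=> is_; rewrite /c big1// => j /eqP ji; move: is_; rewrite -ji ws.
have cZ v : \sum_i c v i *: Z i = v.
  rewrite [RHS]dec (partition_big w xpredT)//=; apply: eq_bigr => i _.
  by rewrite /c scaler_suml; apply: eq_bigr => j /eqP ->.
(* Replacing [r] by [r + r_k c] in the sum of the [r_i Z i] adds [r_k v], the same as replacing
   [Z k] by [Z k + v]. *)
have hkE v : 1 + c v k != 0 -> hk P xi Q Z k (Z k + v) =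
    \int[mu]_(r in shears k s (shear_param k (c v)) @^-1` B) f r.
  move=> ck; rewrite /hk /gprob /Rintegral -Pxi; last exact: measurable_preimage_shears.
  congr (fine (P _)); apply/funext => x; congr Q.
  under [RHS]eq_bigr do rewrite (tnth_shears_param _ _ us ks (c0 v) ck) scalerDl.
  rewrite big_split/=.
  have -> : \sum_(i < N) (c v i * tnth (xi x) k) *: Z i = tnth (xi x) k *: v.
    rewrite -[in RHS](cZ v) scaler_sumr; apply: eq_bigr => i _.
    by rewrite scalerA mulrC.
  rewrite (bigD1 k)//= eqxx [in RHS](bigD1 k)//= scalerDr -!addrA; congr (_ + _).
  rewrite addrC; congr (_ + _); apply: eq_bigr => i /negbTE ik; by rewrite ik.
have hk0 : hk P xi Q Z k (Z k) = \int[mu]_(r in B) f r.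
  have c00 i : c 0 i = 0.
    by rewrite /c big1// => j _; rewrite /inner big1// => l _; rewrite mxE mulr0.
  have ck : 1 + c 0 k != 0 by rewrite c00 addr0 oner_eq0.
  rewrite -[in LHS](addr0 (Z k)) hkE//; congr (Rintegral mu _ f).
  apply/funext => r; congr B; apply: eq_from_tnth => i.
  by rewrite (tnth_shears_param _ _ us ks (c0 0) ck) c00 mul0r addr0.
pose m j := \int[mu]_(r in B) Phi f k (w j) r.
pose g l := - \sum_j e j 0 l * m j.
have gE (v : 'rV[R]_n) : \sum_l v 0 l * g l = - \sum_j inner (e j) v * m j.
  rewrite /g; under eq_bigr do rewrite mulrN mulr_sumr.
  rewrite sumrN exchange_big; congr (- _); apply: eq_bigr => j _ /=.
  by rewrite /inner mulr_suml; apply: eq_bigr => l _; rewrite mulrCA mulrA.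
pose K := 1 + \sum_j \sum_l `|e j 0 l|.
have K0 : 0 < K by rewrite ltr_pwDl// !sumr_ge0// => j _; rewrite sumr_ge0.
have innerK j v : `|inner (e j) v| <= K * `|v|.
  apply: (@le_trans _ _ ((\sum_l `|e j 0 l|) * `|v|)).
    rewrite mulr_suml (le_trans (ler_norm_sum _ _ _))// ler_sum// => l _.
    by rewrite normrM ler_wpM2l// ler_norm_entry.
  rewrite ler_wpM2r// /K [in leRHS](bigD1 j)//= addrCA lerDl addr_ge0// sumr_ge0// => i _.
  by rewrite sumr_ge0.
have cK v i : `|c v i| <= K * `|v|.
  have [/sP[j ->]|/c0 ->] := boolP (i \in s); first by rewrite cw.
  by rewrite normr0 mulr_ge0// ltW.
have fs j : j \in s ->
    (forall r, derivable (fun t => f (tupd r j t)) (tnth r j) 1) /\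
    mu.-integrable setT (fun r => (Phi f k j r)%:E).
  by move=> /sP[i ->]; split; [exact: fder|exact: iPhi].
suff hexp : forall eps, 0 < eps -> exists2 d, 0 < d & forall v : 'rV[R]_n, `|v| < d ->
    `|hk P xi Q Z k (Z k + v) - hk P xi Q Z k (Z k) - \sum_l v 0 l * g l| <= eps * `|v|.
  have [dh DE] := differentiable_of_expansion hexp.
  split => //; apply/rowP => l; rewrite mxE DE.
  have Dm j : 'D_(Z (w j)) (hk P xi Q Z k) (Z k) = - m j.
    rewrite DE gE (bigD1 j)//= dualZ eqxx mul1r big1 ?addr0// => i ij.
    by rewrite dualZ (negbTE ij) mul0r.
  rewrite (bigD1 l)//= mxE !eqxx mul1r big1 ?addr0; last first.
    by move=> i il; rewrite mxE eqxx (negbTE il) mul0r.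
  rewrite summxE /g -sumrN; apply: eq_bigr => j _.
  transitivity ((- m j *: e j) 0 l); first by rewrite mxE mulNr mulrC.
  (* The gradient is the combination of the [e j] with coefficients [- m j], the directional
     derivatives. Expanding [e j] itself in the basis produces the Gram matrix of the dual basis. *)
  rewrite [in LHS](dec (e j)) scaler_sumr; congr (fun_of_matrix _ 0 l).
  apply: eq_bigr => i _.
  by rewrite scalerA -Dm innerC.
move=> eps eps0.
(* The coordinates of [v] have absolute sum at most [n K |v|]; the [+ 1] keeps the divisor positive
   when [n = 0]. *)
have nK0 : 0 < n%:R * K + 1 by rewrite ltr_wpDl// mulr_ge0// ltW.
have eps'0 : 0 < eps / (n%:R * K + 1) by rewrite divr_gt0.
have [d /andP[d0 d12] hd] := affine_expansion muP mf f0 intf fs us ks mB eps'0.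
exists (d / K) => [|v vd]; first by rewrite divr_gt0.
have cd i : `|c v i| < d.
  by rewrite (le_lt_trans (cK v i))// mulrC -ltr_pdivlMr.
have ck : 1 + c v k != 0.
  by have := cd k; rewrite ltr_norml => /andP[cdk _]; rewrite gt_eqF//; lra.
have := hd _ cd; rewrite -hkE// -hk0 !big_s.
under eq_bigr do rewrite cw -/(m _).
rewrite gE opprK => /le_trans; apply.
apply: (@le_trans _ _ (eps / (n%:R * K + 1) * (n%:R * K * `|v|))).
  rewrite ler_wpM2l ?(ltW eps'0)//.
  apply: (@le_trans _ _ (\sum_(j < n) K * `|v|)).
    by apply: ler_sum => j _; rewrite cw.
  by rewrite sumr_const card_ord -mulrA mulr_natl.
rewrite mulrA ler_wpM2r// -mulrA ler_piMr ?(ltW eps0)// mulrC ler_pdivrMr// mul1r.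
by rewrite lerDl.
Qed.
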